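(* The relation $\mathbb{T}_0$ on $2^\omega$ is $\sqsubseteq_c$-minimal among non-pot$(\Pi^0_1)$ relations.
   Context: Let $\psi:\omega\to2^{<\omega}$ list finite binary sequences by increasing length and lexicographically within each length, $s_n:=\psi(n)0^{n-|\psi(n)|}$, $\mathbb{G}_0:=\{(s_n0\gamma,s_n1\gamma)\mid n\in\omega,\gamma\in2^\omega\}$, $\mathbb{T}_0:=\{(\varepsilon\alpha,(1-\varepsilon)\beta)\mid\varepsilon\in2,(\alpha,\beta)\in\mathbb{G}_0\}$. A set $E\subseteq X\times X$ ($X$ Polish) is pot$(\Pi^0_1)$ if there are finer Polish topologies $\sigma,\tau$ on $X$ making $E$ closed in $(X,\sigma)\times(X,\tau)$. $(X,A)\sqsubseteq_c(Y,B)$ means there is an injective continuous $f:X\to Y$ with $(f(x),f(y))\in B\iff(x,y)\in A$. A relation $A$ on $2^\omega$ is $\sqsubseteq_c$-minimal among non-pot$(\Pi^0_1)$ relations if it is not pot$(\Pi^0_1)$ and whenever $X$ is Polish, $S$ is a non-pot$(\Pi^0_1)$ relation on $X$ and $(X,S)\sqsubseteq_c(2^\omega,A)$, then $(2^\omega,A)\sqsubseteq_c(X,S)$. *)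

(* Defs.v *)
From HB Require Import structures.
From mathcomp Require Import all_boot all_order all_algebra.
From mathcomp Require Import all_classical all_reals.
From mathcomp Require Import topology cantor.

Set Implicit Arguments.
Unset Strict Implicit.
Unset Printing Implicit Defensive.

Local Open Scope classical_set_scope.

Definition separable (T : topologicalType) : Prop :=
  exists2 D : set T, countable D & dense D.

(* A metric structure on the carrier of T that induces the topology of T and
   is complete. It is stated with F --> x instead of completeType because the
   latter is pointed. *)
Definition completely_metrizable (R : realType) (T : topologicalType) : Prop :=
  exists d : Metric R T, let M : metricType R := Metric.Pack d in
    (forall x : T, @nbhs M M x = @nbhs T T x) /\
    (forall F : set_system M, ProperFilter F -> cauchy F ->
       exists x : M, F --> x).

Definition polish (R : realType) (T : topologicalType) : Prop :=
  separable T /\ completely_metrizable R T.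

(* The space (X, sigma), as opposed to X with its canonical topology. *)
Definition retopologize (X : Type) (sigma : Topological X) : topologicalType :=
  Topological.Pack sigma.

Definition finer (X : topologicalType) (sigma : Topological X) : Prop :=
  forall U : set X, @open X U -> @open (retopologize sigma) U.

Definition pot_closed (R : realType) (X : topologicalType)
    (E : set (X * X)) : Prop :=
  exists sigma tau : Topological X,
    [/\ finer sigma, polish R (retopologize sigma),
        finer tau, polish R (retopologize tau) &
        @closed (retopologize sigma * retopologize tau)%type E].

Definition reduces_c (X : topologicalType) (A : set (X * X))
    (Y : topologicalType) (B : set (Y * Y)) : Prop :=
  exists f : X -> Y, [/\ injective f, continuous f &
    forall x y : X, B (f x, f y) <-> A (x, y)].

Definition minimal_non_pot_closed (R : realType)
    (A : set (cantor_space * cantor_space)) : Prop :=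
  ~ pot_closed R A /\
  forall (X : topologicalType) (S : set (X * X)),
    polish R X -> ~ pot_closed R S ->
    reduces_c S A -> reduces_c A S.

(* Binary digits are booleans: 0 is false, 1 is true. *)

(* All binary words of length k, in lexicographic order. *)
Fixpoint words (k : nat) : seq (seq bool) :=
  if k is k'.+1 then
    [seq false :: w | w <- words k'] ++ [seq true :: w | w <- words k']
  else [:: [::]].

(* The lists words 0, ..., words n together have 2 ^ n.+1 - 1 > n entries, so
   the default value of nth is never used. *)
Definition psi (n : nat) : seq bool :=
  nth [::] (flatten [seq words k | k <- iota 0 n.+1]) n.

Definition s_ (n : nat) : seq bool :=
  psi n ++ nseq (n - size (psi n)) false.

Definition prepend (w : seq bool) (a : cantor_space) : cantor_space :=
  fun i => if i < size w then nth false w i else a (i - size w).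

Definition G0 : set (cantor_space * cantor_space) :=
  [set p | exists (n : nat) (gamma : cantor_space),
     p = (prepend (rcons (s_ n) false) gamma,
          prepend (rcons (s_ n) true) gamma)].

Definition T0 : set (cantor_space * cantor_space) :=
  [set p | exists (e : bool) (alpha beta : cantor_space),
     G0 (alpha, beta) /\
     p = (prepend [:: e] alpha, prepend [:: ~~ e] beta)].

(* Main.v *)
(* A Polish space is handled through a code: an injection into some nat^I (I
   countable) with closed image and continuous inverse. Two topologies being
   compared through their codes, potential closedness becomes combinatorial.

   T0 is not pot-closed: given finer Polish topologies, the map sending x to the
   codes of 0x and 1x has closed graph. Each (0x, 1x) lies outside T0, so if T0
   were closed, the Cantor space would be covered by preimages of cylinders
   containing no edge of G0. But one of them is not meager, hence comeager in
   some open set, hence contains both ends of an edge.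

   Minimality: let f reduce S to T0. Only the pairs of twins, (x, y) with
   f x = 0a and f y = 1a, can be limits of S outside S. If the twins are
   covered by countably many Borel rectangles disjoint from S and its inverse
   (they are "small"), then making the sides of these rectangles clopen makes
   S closed. Otherwise, as in the proofs of the G0-dichotomy, a continuous map
   G from the Cantor space to the twins sending edges of G0 at s_k to edges at
   s_(m k) is built from finite approximations. Calling an approximation large
   if its central twins stay non-small when a small set is removed, a large
   approximation has a large extension: otherwise, off a small set, its central
   twins span no edge, and Lusin separation encloses them in a Borel rectangle
   without edges. Taking m increasing, the digit m k of G a is the digit k of
   a, which makes G injective and a reduction, with no appeal to acyclicity. *)

Require Import Defs.
From HB Require Import structures.
From mathcomp Require Import all_boot all_order all_algebra.
From mathcomp Require Import all_classical all_reals topology cantor.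
From mathcomp Require Import lra zify.

Set Implicit Arguments.
Unset Strict Implicit.
Unset Printing Implicit Defensive.
Import Order.TTheory GRing.Theory Num.Theory.
Local Open Scope classical_set_scope.

(** * Codes and Polish topologies *)

(** For finite [s] these are the basic neighbourhoods in a product of discrete copies of nat; all
    topologies are handled through them. *)
Definition agree (I : eqType) (s : seq I) (a b : I -> nat) :=
  forall i, i \in s -> a i = b i.

Lemma agree_cat (I : eqType) (s t : seq I) a b :
  agree (s ++ t) a b <-> agree s a b /\ agree t a b.
Proof.
split=> [h|[h1 h2] i]; last by rewrite mem_cat => /orP[/h1|/h2].
by split=> i hi; apply: h; rewrite mem_cat hi ?orbT.
Qed.

Lemma agree_sym (I : eqType) (s : seq I) a b : agree s a b -> agree s b a.
Proof. by move=> h i /h. Qed.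

(** The range of [c] is closed in nat^I. W has no topology of its own: it receives the one pulled
    back along [c], in which [code_open] expresses neighbourhoods. *)
Definition closed_code (W : Type) (I : eqType) (c : W -> I -> nat) :=
  forall y, (forall s, exists w, agree s (c w) y) -> exists w, c w = y.

Definition code_open (W : Type) (I : eqType) (c : W -> I -> nat) (V : set W)
    (x : W) :=
  exists s, forall x', agree s (c x) (c x') -> V x'.

Definition code_space (R : realType) (X : Type) (c : X -> nat -> nat)
  of injective c : Type := X.

(** * The Polish topology of a closed code *)

Section CodeMetric.
Local Open Scope ring_scope.
Variables (R : realType) (X : choiceType) (c : X -> nat -> nat).
Hypothesis c_inj : injective c.

(** The ultrametric of the Baire space: 1 / (n + 1) for n the first coordinate at which the codes
    differ. *)
Definition code_dist (x y : X) : R :=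
  match pselect (exists n, c x n != c y n) with
  | left h => (ex_minn h).+1%:R^-1
  | right _ => 0
  end.

Lemma code_dist_ge0 x y : 0 <= code_dist x y.
Proof. by rewrite /code_dist; case: pselect => // h; rewrite invr_ge0. Qed.

Lemma code_dist_ge x y n : c x n <> c y n -> n.+1%:R^-1 <= code_dist x y.
Proof.
move=> /eqP hn; rewrite /code_dist; case: pselect => [h|[]]; last by exists n.
case: ex_minnP => m _ /(_ _ hn) mn.
by rewrite lef_pV2 ?posrE ?ltr0n// ler_nat.
Qed.

Lemma code_dist_ltP x y n :
  code_dist x y < n.+1%:R^-1 <-> forall i, (i <= n)%N -> c x i = c y i.
Proof.
split=> [h i hi|h].
  apply: contrapT => /code_dist_ge /le_lt_trans /(_ h).
  by rewrite ltf_pV2 ?posrE ?ltr0n// ltr_nat ltnNge ltnS hi.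
rewrite /code_dist; case: pselect => [k|_]; last by rewrite invr_gt0 ltr0n.
case: ex_minnP => m /eqP hm _; rewrite ltf_pV2 ?posrE ?ltr0n// ltr_nat ltnS.
by rewrite ltnNge; apply/negP => /h.
Qed.

Lemma code_dist_cases x y : code_dist x y = 0 \/
  exists2 n, code_dist x y = n.+1%:R^-1 & c x n <> c y n.
Proof.
rewrite /code_dist; case: pselect => [k|_]; last by left.
by right; case: ex_minnP => m /eqP hm _; exists m.
Qed.

Lemma code_distxx x : code_dist x x = 0.
Proof. by case: (code_dist_cases x x) => // -[n]. Qed.

Lemma code_dist_eq0 x y : code_dist x y = 0 -> x = y.
Proof.
move=> h; apply: c_inj; apply/funext => n; apply: contrapT => /code_dist_ge.
by rewrite h leNgt invr_gt0 ltr0n.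
Qed.

Lemma code_dist_sym x y : code_dist x y = code_dist y x.
Proof.
apply/le_anti/andP; split.
- case: (code_dist_cases x y) => [->|[n -> h]]; first exact: code_dist_ge0.
  by apply: code_dist_ge => /esym.
- case: (code_dist_cases y x) => [->|[n -> h]]; first exact: code_dist_ge0.
  by apply: code_dist_ge => /esym.
Qed.

Lemma code_dist_triangle y x z :
  code_dist x z <= code_dist x y + code_dist y z.
Proof.
case: (code_dist_cases x z) => [->|[n -> h]].
  by rewrite addr_ge0// code_dist_ge0.
have [e|ne] := pselect (c x n = c y n).
  rewrite (le_trans (@code_dist_ge y z n _)) ?lerDr ?code_dist_ge0//.
  by rewrite -e.
by rewrite (le_trans (code_dist_ge ne)) ?lerDl ?code_dist_ge0.
Qed.

HB.instance Definition _ := Choice.on (code_space R c_inj).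
HB.instance Definition _ := @isMetric.Build R (code_space R c_inj) code_dist
  code_distxx code_dist_eq0 code_dist_sym code_dist_triangle.

End CodeMetric.

Lemma nbhs_code_space (R : realType) (X : choiceType) (c : X -> nat -> nat)
    (c_inj : injective c) (x : X) (V : set X) :
  @nbhs _ (code_space R c_inj) x V <-> code_open c V x.
Proof.
split=> [/(@nbhs_ballP R (code_space R c_inj)) [e /= e0 h]|[s h]].
- have [n /= hn] : exists n, (n.+1%:R^-1 < e)%R.
    exists (Num.bound (e^-1)%R).
    rewrite -[ltRHS]invrK ltf_pV2 ?posrE ?ltr0n ?invr_gt0//.
    by rewrite (lt_le_trans (archi_boundP _)) ?ler_nat ?invr_ge0// ltW.
  exists (iota 0 n.+1) => x' hx'; apply: h; rewrite ballEmdist /=.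
  apply: lt_trans hn; apply/code_dist_ltP => i hi; apply: hx'.
  by rewrite mem_iota.
- apply/(@nbhs_ballP R (code_space R c_inj)).
  exists ((\max_(i <- s) i).+1%:R^-1)%R; first by rewrite /= invr_gt0 ltr0n.
  move=> x'; rewrite ballEmdist /= => /code_dist_ltP hx'; apply: h => i hi.
  by apply: hx'; apply: leq_bigmax_seq.
Qed.

(** Reindexing by nat. Numbers that encode no index get the constant 0, which keeps the range
    closed. *)
Definition nat_code (W : Type) (I : countType) (c : W -> I -> nat) w n :=
  if pickle_inv n is Some i then c w i else 0.

Lemma nat_codeE (W : Type) (I : countType) (c : W -> I -> nat) w i :
  nat_code c w (pickle i) = c w i.
Proof. by rewrite /nat_code pickleK_inv. Qed.

Lemma nat_code_agree (W : Type) (I : countType) (c : W -> I -> nat) s w w' :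
  agree [seq pickle i | i <- s] (nat_code c w) (nat_code c w') <->
  agree s (c w) (c w').
Proof.
split=> h i; last first.
  by case/mapP => j js ->; rewrite !nat_codeE h.
by move=> si; have := h (pickle i); rewrite !nat_codeE; apply; apply: map_f.
Qed.

Lemma nat_code_open (W : Type) (I : countType) (c : W -> I -> nat) V x :
  code_open (nat_code c) V x <-> code_open c V x.
Proof.
split=> -[s h]; last first.
  by exists [seq pickle i | i <- s] => x' /nat_code_agree; apply: h.
exists (pmap pickle_inv s) => x' hx'; apply: h => n ns.
rewrite /nat_code; case E: (pickle_inv n) => [i|//]; apply: hx'.
by rewrite mem_pmap; apply/mapP; exists n.
Qed.

Lemma nat_code_inj (W : Type) (I : countType) (c : W -> I -> nat) :
  injective c -> injective (nat_code c).
Proof.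
move=> ci x y h; apply: ci; apply/funext => i.
by rewrite -(nat_codeE c x) h nat_codeE.
Qed.

Lemma nat_code_closed (W : Type) (I : countType) (c : W -> I -> nat) :
  closed_code c -> closed_code (nat_code c).
Proof.
move=> cc y hy; have [|w hw] := cc (y \o pickle).
  move=> s; have [w hw] := hy [seq pickle i | i <- s].
  by exists w => i si; rewrite -nat_codeE; apply: hw; apply: map_f.
exists w; apply/funext => n; rewrite /nat_code.
case E: (pickle_inv n) => [i|].
  by rewrite hw /=; congr y; have := @pickle_invK I n; rewrite E.
by have [v /(_ n (mem_head _ _))] := hy [:: n]; rewrite /nat_code E.
Qed.

Lemma code_polish (R : realType) (X : topologicalType) (I : countType)
    (c : X -> I -> nat) : closed_code c -> injective c ->
  exists sigma : Topological X, polish R (retopologize sigma) /\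
    forall (x : X) V, @nbhs _ (retopologize sigma) x V <-> code_open c V x.
Proof.
move=> cc ci.
have cn := nat_code_closed cc; have ci' := nat_code_inj ci.
pose T := code_space R ci'.
have nT (x : X) (V : set X) : @nbhs _ T x V <-> code_open (nat_code c) V x.
  exact: nbhs_code_space.
exists (Topological.class T); split; last first.
  by move=> x V; rewrite -nat_code_open -nT.
split.
(* Separability: each finite list of constraints on coordinates contributes one point satisfying it,
   if there is one. *)
- have [|g hg] := @choice (seq (I * nat)) (set X) (fun l G =>
      (G = set0 /\ forall x, ~ forall p, p \in l -> c x p.1 = p.2) \/
      exists2 x, G = [set x] & forall p, p \in l -> c x p.1 = p.2).
    move=> l.
    have [[x hx]|nx] := pselect (exists x, forall p, p \in l -> c x p.1 = p.2).
      by exists [set x]; right; exists x.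
    by exists set0; left; split=> // x hx; apply: nx; exists x.
  exists (\bigcup_l g l).
    apply: bigcup_countable => // l _.
    by case: (hg l) => [[->]|[x ->]]//; apply: countable0.
  move=> O [x Ox] oO.
  have /nT /nat_code_open [s hs] : nbhs (x : T) O by exact: open_nbhs_nbhs.
  case: (hg [seq (i, c x i) | i <- s]) => [[_ /(_ x)]|[z gz hz]].
    by case=> p /mapP [i _ ->].
  exists z; split; last by exists [seq (i, c x i) | i <- s] => //; rewrite gz.
  by apply: hs => i si; apply/esym/(hz (i, c x i)); apply: map_f.
- exists (Metric.class T); split=> // F PF cF.
  (* A Cauchy filter fixes each coordinate [n], to its value at some [z n]; the limit is the point
     coded by these values. *)
  have [n|z hz] := @choice nat X (fun n z =>
      F [set x | nat_code c x n = nat_code c z n]).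
    have /cauchyP := cF => /(_ (n.+1%:R^-1)%R) [].
      by rewrite invr_gt0 ltr0n.
    move=> z hz; exists z; apply: filterS hz => x.
    by rewrite ballEmdist /= => /code_dist_ltP /(_ n (leqnn n)) /esym.
  have hzs s : F [set x | agree s (nat_code c x) (fun n => nat_code c (z n) n)].
    elim: s => [|n s IH]; first by apply: filterS filterT.
    apply: filterS2 (hz n) IH => x /= hn hs m.
    by rewrite inE => /predU1P [->//|]; apply: hs.
  have [|w hw] := cn (fun n => nat_code c (z n) n).
    by move=> s; have [w] := filter_ex (hzs s); exists w.
  exists w => V /nT [s hs]; apply: filterS (hzs s) => x hx; apply: hs.
  by rewrite hw; apply: agree_sym.
Qed.

(* Adding 1 leaves the value 0 for "no such index". *)
Definition first_index (P : nat -> Prop) : nat :=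
  match pselect (exists n, `[< P n >]) with
  | left h => (ex_minn h).+1
  | right _ => 0
  end.

Lemma first_index_eq0 P : (first_index P = 0) <-> forall n, ~ P n.
Proof.
rewrite /first_index; case: pselect => [h|nh].
  by split=> // nP; have [n /asboolP Pn] := h; case: (nP n).
by split=> // _ n Pn; apply: nh; exists n; apply/asboolP.
Qed.

Lemma first_indexS P n : first_index P = n.+1 ->
  P n /\ forall m, m < n -> ~ P m.
Proof.
rewrite /first_index; case: pselect => // h; case: ex_minnP => k /asboolP Pk kP.
by case=> <-; split=> // m mk /asboolP /kP; rewrite leqNgt mk.
Qed.

(** A first index is decided by the predicate up to that index, so finitely many coordinates control
    it. The closure arguments about codes rest on this. *)
Lemma first_index_agree P Q :
  (forall n, n <= maxn (first_index P) (first_index Q) -> P n <-> Q n) ->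
  first_index P = first_index Q.
Proof.
move=> h; case EP: (first_index P) => [|p]; case EQ: (first_index Q) => [|q] //.
- have [Qq _] := first_indexS EQ.
  have /first_index_eq0/(_ q) := EP; case; apply/h => //.
  by rewrite EP EQ leq_max leqnSn orbT.
- have [Pp _] := first_indexS EP.
  have /first_index_eq0/(_ p) := EQ; case; apply/h => //.
  by rewrite EP EQ leq_max leqnSn.
- have [Pp nP] := first_indexS EP; have [Qq nQ] := first_indexS EQ.
  have [pq|qp|->//] := ltngtP p q.
    case: (nQ p pq); apply/h => //; rewrite EP EQ leq_max leqnSn //.
  case: (nP q qp); apply/h => //; rewrite EP EQ leq_max leqnSn orbT //.
Qed.

(** * A closed code for every Polish space *)

Section PolishCode.
Variables (R : realType) (X : topologicalType).

Lemma polish_regular_base : polish R X -> exists U : nat -> set X,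
  (forall n, open (U n)) /\
  forall x V, nbhs x V -> exists n, U n x /\ closure (U n) `<=` V.
Proof.
move=> [[D cD dD]] [d [nd _]]; pose M : metricType R := Metric.Pack d.
have nX (x : X) (V : set X) : nbhs x V <-> exists2 e : R, (0 < e)%R & @ball R M x e `<=` V.
  rewrite -nd; exact: (@nbhs_ballP R M).
have bX (x : X) (e : R) : (0 < e)%R -> nbhs x (@ball R M x e : set X).
  by move=> e0; apply/nX; exists e.
have [h hinj] : exists h : X -> nat, {in D &, injective h}.
  by have /countable_injP [h /= hi] := cD; exists h.
(* At most one [a] in D has [h a = p.1], so the union is a single ball interior or empty, and no
   inverse of [h] is needed. *)
pose B (p : nat * nat) : set X := \bigcup_(a in [set a | D a /\ h a = p.1])
  (@ball R M a (p.2.+1%:R^-1)%R : set X)°.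
pose U n : set X := if unpickle n is Some p then B p else set0.
exists U; split.
  move=> n; rewrite /U; case: unpickle => [p|]; last exact: open0.
  by apply: bigcup_open => a _; exact: open_interior.
move=> x V /nX [e e0 eV].
(* Below, [z] is within r of [w], [w] within r of [a], and [a] within r of [x], whence the third of
   [e]. *)
have [n /= hn] : exists n, (n.+1%:R^-1 < e / 3)%R.
  exists (Num.bound ((e / 3)^-1)%R).
  rewrite -[ltRHS]invrK ltf_pV2 ?posrE ?ltr0n ?invr_gt0 ?divr_gt0//.
  by rewrite (lt_le_trans (archi_boundP _)) ?ler_nat ?invr_ge0 ?divr_ge0// ltW.
set r : R := (n.+1%:R^-1)%R in hn.
have r0 : (0 < r)%R by rewrite invr_gt0 ltr0n.
have r20 : (0 < r / 2)%R by rewrite divr_gt0.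
have [a [xa Da]] : ((@ball R M x (r / 2)%R : set X)° `&` D) !=set0.
  by apply: dD; [exists x; exact: bX|exact: open_interior].
have {}xa : @ball R M x (r / 2)%R a by apply: interior_subset xa.
have Bxa : (B (h a, n) : set X) `<=` (@ball R M a r : set X).
  move=> z [b [Db /= ba] /interior_subset]; suff -> : b = a by [].
  by apply: hinj; rewrite ?inE.
exists (pickle (h a, n)); rewrite /U pickleK; split.
  exists a => //; apply/nX; exists (r / 2)%R => // z xz.
  apply: (@le_ball R M a (r / 2 + r / 2)%R); first by rewrite -splitr.
  by apply: ball_triangle xz; apply: ball_sym.
move=> z /(_ _ (bX z _ r0)) [w [/Bxa aw zw]]; apply: eV.
apply: (@le_ball R M x (r + r + r)%R); first by lra.
apply: (@ball_triangle R M w); last exact: ball_sym.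
apply: (@ball_triangle R M a) => //.
by apply: le_ball xa; lra.
Qed.

End PolishCode.

(** Coordinate [inl k] is nonzero exactly on [U k], by regularity of the base; coordinate [inr n]
    names a basic set around the point inside a ball of radius 1 / (n + 1). For a limit [y] of
    codes, the second kind yields a Cauchy filter, and the first kind shows that its limit point has
    code [y]. *)
Lemma polish_code (R : realType) (X : topologicalType) : polish R X ->
  exists c : X -> nat + nat -> nat, closed_code c /\
    forall x V, nbhs x V -> code_open c V x.
Proof.
move=> PX; have [U [oU rU]] := polish_regular_base PX.
have [_ [d [nd dc]]] := PX; pose M : metricType R := Metric.Pack d.
have nX (x : X) (V : set X) : nbhs x V <-> exists2 e : R, (0 < e)%R & @ball R M x e `<=` V.
  rewrite -nd; exact: (@nbhs_ballP R M).
pose rel (i : nat + nat) (j : nat) : Prop := match i with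
  | inl k => closure (U j) `<=` U k
  | inr n => exists a : M, U j `<=` ball a (n.+1%:R^-1)%R
  end.
pose c (x : X) i := first_index (fun j => U j x /\ rel i j).
have cU x k : U k x <-> c x (inl k) <> 0.
  split=> [Ukx|].
    move=> /first_index_eq0 h.
    by have [j [Uj cj]] := rU x _ (open_nbhs_nbhs (conj (oU k) Ukx)); case: (h j).
  case E: (c x (inl k)) => [|j] // _.
  by have [[Ujx /= cj] _] := first_indexS E; apply/cj/subset_closure.
exists c; split; last first.
  move=> x V /rU [j [Ujx cj]]; exists [:: inl j] => x' hx'.
  apply/cj/subset_closure/cU; rewrite -hx' ?mem_head//; exact/cU.
move=> y hy.
pose F : set_system M := [set A | exists s, [set x | agree s (c x) y] `<=` A].
have FF : ProperFilter F.
  split.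
    by move=> [s hs]; have [w hw] := hy s; apply: (hs w).
  split.
  - by exists [::].
  - move=> A B [s hs] [t ht]; exists (s ++ t) => x /agree_cat [xs xt].
    by split; [apply: hs|apply: ht].
  - by move=> A B AB [s hs]; exists s => x /hs /AB.
have cF : cauchy F.
  apply: cauchy_exP => e e0.
  have [n /= hn] : exists n, (n.+1%:R^-1 < e)%R.
    exists (Num.bound (e^-1)%R).
    rewrite -[ltRHS]invrK ltf_pV2 ?posrE ?ltr0n ?invr_gt0//.
    by rewrite (lt_le_trans (archi_boundP _)) ?ler_nat ?invr_ge0// ltW.
  have yn : y (inr n) <> 0.
    have [w /(_ _ (mem_head _ _)) <-] := hy [:: inr n].
    move=> /first_index_eq0 h.
    have [|j [Uj cj]] := rU w (@ball R M w (n.+1%:R^-1)%R).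
      by apply/nX; exists (n.+1%:R^-1)%R => //; rewrite invr_gt0 ltr0n.
    apply: (h j); split=> //; exists w.
    exact: subset_trans (@subset_closure _ _) cj.
  case E: (y (inr n)) => [//|j].
  have [w /(_ _ (mem_head _ _)) hw] := hy [:: inr n].
  have [a ha] : exists a : M, U j `<=` ball a (n.+1%:R^-1)%R.
    by rewrite E in hw; have [[_ ?] _] := first_indexS hw.
  exists a, [:: inr n] => x /(_ _ (mem_head _ _)); rewrite E => hx.
  have [[Ujx _] _] := first_indexS hx.
  by apply: le_ball (ha _ Ujx); apply: ltW.
have [x Fx] := dc F FF cF.
have Fx' (V : set X) : nbhs (x : X) V -> exists s, [set z | agree s (c z) y] `<=` V.
  by move=> nV; apply: Fx; rewrite [nbhs _]nd.
exists x.
(* Membership of the limit in [U k] is read off [y]: the closure in [rel] keeps the limit inside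
   [U k]. *)
have xU k : U k x <-> y (inl k) <> 0.
  split=> [Ukx yk|].
    have [s hs] := Fx' _ (open_nbhs_nbhs (conj (oU k) Ukx)).
    have [w /agree_cat[ws wk]] := hy (s ++ [:: inl k]).
    by have /cU := hs w ws; rewrite wk ?mem_head.
  case E: (y (inl k)) => [//|j] _.
  have [w /(_ _ (mem_head _ _)) ] := hy [:: inl k]; rewrite E => hw.
  have [[_ /= cj] _] := first_indexS hw.
  apply: cj => V /Fx' [s hs].
  have [v /agree_cat[vs vk]] := hy (s ++ [:: inl k]).
  exists v; split; last exact: hs.
  by have := vk (inl k) (mem_head _ _); rewrite E => /first_indexS [[]].
apply/funext => i.
(* [v] has code [y] at [i], and at enough coordinates [inl k] to lie in the same sets [U k] as [x]
   up to both first indices. *)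
have [v hv] := hy (i :: [seq inl k | k <- iota 0 (maxn (c x i) (y i)).+1]).
have vi := hv i (mem_head _ _); rewrite -vi.
apply: first_index_agree => n hn.
suff : U n x <-> U n v by move=> ->.
rewrite xU cU hv // inE map_f ?orbT//.
by rewrite mem_iota /= add0n ltnS -vi.
Qed.

(** * Borel sets and Lusin separation *)

Lemma tree_branch (S : Type) (T : seq S -> Prop) :
  T [::] -> (forall u, T u -> exists k, T (rcons u k)) ->
  exists y : nat -> S, forall n, T (mkseq y n).
Proof.
move=> T0 Tr; have [k0 _] := Tr _ T0.
have [u|g hg] := @choice (seq S) S (fun u k => T u -> T (rcons u k)).
  have [/Tr [k hk]|nT] := pselect (T u); first by exists k.
  by exists k0.
pose st n := iter n (fun u => rcons u (g u)) [::].
exists (fun n => g (st n)).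
have E n : mkseq (fun n => g (st n)) n = st n.
  by elim: n => // n IH; rewrite mkseqS IH.
by elim=> [//|n]; rewrite !E /=; apply: hg.
Qed.

Definition pair_code (X I J : Type) (c : X -> I -> nat) (r : X -> J -> nat)
  (x : X) (j : I + J) := match j with inl i => c x i | inr i => r x i end.

Lemma agree_pair (X : Type) (I J : eqType) (c : X -> I -> nat) (r : X -> J -> nat)
    s t x (y : I + J -> nat) :
  agree (map inl s ++ map inr t) (pair_code c r x) y <->
  agree s (c x) (y \o inl) /\ agree t (r x) (y \o inr).
Proof.
rewrite agree_cat; split=> -[h k]; split=> i.
- by move=> si; apply: (h (inl i)); rewrite map_f.
- by move=> si; apply: (k (inr i)); rewrite map_f.
- by case/mapP => j js ->; apply: h.
- by case/mapP => j js ->; apply: k.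
Qed.

Section Borel.
Variables (X : Type) (I : countType) (c : X -> I -> nat).

(** The graph is closed for the topology coded by [c] and the product topology on nat^J. Appending
    such an [r] to a closed code keeps it closed: this refines the topology so that [r] becomes
    continuous. *)
Definition closed_graph (J : eqType) (r : X -> J -> nat) :=
  forall x y,
    (forall s t, exists2 x', agree s (c x') (c x) & agree t (r x') y) ->
    r x = y.

(* P is clopen in the finer Polish topology coded by c and r, so that this is
   Borelness (of a subset of a Polish space coded by c). *)
Definition borel (P : set X) :=
  exists2 r : X -> nat -> nat, closed_graph r & forall x, P x <-> r x 0 <> 0.

Lemma closed_pair_code (J : eqType) (r : X -> J -> nat) :
  closed_code c -> closed_graph r -> closed_code (pair_code c r).
Proof.
move=> cc cr y hy; have [|x hx] := cc (y \o inl).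
  by move=> s; have [x /agree_pair [h _]] := hy (map inl s ++ map inr [::]); exists x.
exists x; apply/funext; case=> [i|j] /=; first by rewrite hx.
suff -> : r x = y \o inr by [].
apply: cr => s t; have [x' /agree_pair [h k]] := hy (map inl s ++ map inr t).
by exists x'; rewrite ?hx.
Qed.

Lemma closed_graph_nat_code (J : countType) (r : X -> J -> nat) :
  closed_graph r -> closed_graph (nat_code r).
Proof.
move=> hr x y hy; have rE : r x = y \o pickle.
  apply: hr => s t; have [x' h k] := hy s [seq pickle i | i <- t].
  by exists x' => // i ti; rewrite /= -k ?nat_codeE// map_f.
apply/funext => n; rewrite /nat_code; case E: (pickle_inv n) => [i|].
  by rewrite rE /=; congr y; have := @pickle_invK J n; rewrite E.
by have [x' _ /(_ n (mem_head _ _))] := hy [::] [:: n]; rewrite /nat_code E.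
Qed.

(** The truth value of [p (r x j)] is put in front of a reindexed copy of [r], since [borel] tests
    coordinate 0. As it depends on one coordinate of [r], the graph stays closed. *)
Lemma borel_preimage (J : countType) (r : X -> J -> nat) (j : J)
    (p : nat -> Prop) (P : set X) : closed_graph r ->
  (forall x, P x <-> p (r x j)) -> borel P.
Proof.
move=> cr hP.
exists (fun x n => if n is k.+1 then nat_code r x k else nat_of_bool `[< p (r x j) >]).
  move=> x y hy; have rE : nat_code r x = y \o S.
    apply: (closed_graph_nat_code cr) => s t.
    have [x' h k] := hy s (map S t).
    by exists x' => // i ti; apply: (k i.+1); apply: map_f.
  apply/funext => -[|n]; last exact: (congr1 (@^~ n) rE).
  have [x' _ h] := hy [::] [:: 0; (pickle j).+1].
  rewrite -(h 0) ?mem_head// -(nat_codeE r x) rE /= -(h (pickle j).+1) ?nat_codeE//.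
  by rewrite !inE eqxx orbT.
by move=> x; rewrite hP; case: asboolP.
Qed.

Lemma borel_basic i k : borel [set x | c x i = k].
Proof.
apply: (@borel_preimage I c i (fun m => m = k)) => // x y hy.
apply/funext => i'; have [x' h h'] := hy [:: i'] [:: i'].
by rewrite -h ?mem_head// h' ?mem_head.
Qed.

Lemma borel0 : borel set0.
Proof.
apply: (@borel_preimage unit (fun _ _ => 0) tt (fun _ => False)) => // x y hy.
by apply/funext => -[]; have [_ _ /(_ tt (mem_head _ _))] := hy [::] [:: tt].
Qed.

Lemma borelC P : borel P -> borel (~` P).
Proof.
move=> [r cr hr]; apply: (@borel_preimage _ r 0 (fun m => m = 0)) => // x.
by rewrite /setC /= hr; split=> [/contrapT|->].
Qed.

Lemma borel_bigcup (P : nat -> set X) :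
  (forall i, borel (P i)) -> borel (\bigcup_i P i).
Proof.
move=> bP.
have [i|r hr] := @choice nat (X -> nat -> nat)
    (fun i r => closed_graph r /\ forall x, P i x <-> r x 0 <> 0).
  by have [r ? ?] := bP i; exists r.
(* Coordinate [None] is the first [i] with [x] in [P i], so it is nonzero exactly on the union. *)
pose q x (j : option (nat * nat)) :=
  if j is Some p then r p.1 x p.2 else first_index (fun i => r i x 0 <> 0).
apply: (@borel_preimage _ q None (fun m => m <> 0)).
  move=> x y hy; have rE i n : r i x n = y (Some (i, n)).
    suff -> : r i x = fun n => y (Some (i, n)) by [].
    apply: (hr i).1 => s t; have [x' h k] := hy s [seq Some (i, n) | n <- t].
    exists x' => // m tm; rewrite -k //.
    exact: (map_f (fun n => Some (i, n))).
  apply/funext => -[[i n]|]; first exact: rE.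
  have [x' _ h] := hy [::] (None :: [seq Some (i, 0) | i <-
    iota 0 (maxn (q x None) (y None)).+1]).
  rewrite -(h None) ?mem_head//; apply: first_index_agree => n hn.
  suff -> : r n x 0 = r n x' 0 by [].
  rewrite rE -h // inE (map_f (fun i => Some (i, 0))) ?orbT//.
  by rewrite mem_iota add0n ltnS -(h None) ?mem_head.
move=> x /=; rewrite first_index_eq0; split.
  by move=> [i _ /(hr i).2 h] /(_ i).
move=> /existsNP [i /contrapT ri]; exists i => //; exact/(hr i).2.
Qed.

Lemma borel_bigcap (P : nat -> set X) :
  (forall i, borel (P i)) -> borel (\bigcap_i P i).
Proof.
move=> bP; rewrite -[X in borel X]setCK setC_bigcap.
by apply: borelC; apply: borel_bigcup => i; apply: borelC.
Qed.

Definition separated (A B : set X) :=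
  exists P, [/\ borel P, A `<=` P & B `<=` ~` P].

(** From separators P(i, j) of the pairs, take the union over i of the intersections over j. *)
Lemma separated_bigcup (A B : nat -> set X) :
  (forall i j, separated (A i) (B j)) ->
  separated (\bigcup_i A i) (\bigcup_j B j).
Proof.
move=> h.
have [p|P hP] := @choice (nat * nat) (set X) (fun p P =>
  [/\ borel P, A p.1 `<=` P & B p.2 `<=` ~` P]); first exact: h.
exists (\bigcup_i \bigcap_j P (i, j)); split.
- by apply: borel_bigcup => i; apply: borel_bigcap => j; case: (hP (i, j)).
- by move=> x [i _ Ax]; exists i => // j _; case: (hP (i, j)) => _ + _; apply.
- move=> x [j _ Bx] [i _ /(_ j Logic.I)].
  by case: (hP (i, j)) => _ _; apply.
Qed.

End Borel.

Lemma closed_code_sig (W : Type) (I : eqType) (c : W -> I -> nat) (K : set W) :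
  closed_code c ->
  (forall w, (forall s, exists2 w', K w' & agree s (c w') (c w)) -> K w) ->
  closed_code (fun w : {w | K w} => c (sval w)).
Proof.
move=> cc cK y hy; have [|w hw] := cc y.
  by move=> s; have [w h] := hy s; exists (sval w).
have Kw : K w.
  apply: cK => s; have [[w' Kw'] h] := hy s.
  by exists w' => //; rewrite hw.
by exists (exist _ w Kw).
Qed.

Definition code_cont (W X : Type) (IW I : eqType) (cW : W -> IW -> nat)
    (c : X -> I -> nat) (f : W -> X) :=
  forall w i, exists s, forall w', agree s (cW w') (cW w) ->
    c (f w') i = c (f w) i.

Lemma code_cont_seq (W X : Type) (IW I : eqType) (cW : W -> IW -> nat)
    (c : X -> I -> nat) (f : W -> X) : code_cont cW c f ->
  forall w s, exists t, forall w', agree t (cW w') (cW w) ->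
    agree s (c (f w')) (c (f w)).
Proof.
move=> fc w; elim=> [|i s [t ht]]; first by exists [::].
have [u hu] := fc w i; exists (u ++ t) => w' /agree_cat[/hu e /ht h] j.
by rewrite inE => /predU1P[->//|]; apply: h.
Qed.

Section Separation.
Variables (X : Type) (I : countType) (c : X -> I -> nat).
Hypothesis c_inj : injective c.

Definition cyl (W : Type) (cW : W -> nat -> nat) (u : seq nat) :=
  [set w | forall i, i < size u -> cW w i = nth 0 u i].

Lemma cyl_rcons (W : Type) (cW : W -> nat -> nat) u :
  cyl cW u = \bigcup_k cyl cW (rcons u k).
Proof.
apply/seteqP; split=> [w hw|w [k _ hw] i iu].
  exists (cW w (size u)) => // i; rewrite size_rcons ltnS nth_rcons.
  by case: ltngtP => // [/hw//|->].
by rewrite hw ?size_rcons ?ltnS 1?ltnW// nth_rcons iu.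
Qed.

Lemma cyl_mkseq (W : Type) (cW : W -> nat -> nat) y n w :
  cyl cW (mkseq y n) w <-> forall i, i < n -> cW w i = y i.
Proof.
rewrite /cyl /= size_mkseq; split=> h i hi; have := h i hi.
  by rewrite nth_mkseq.
by rewrite nth_mkseq.
Qed.

Lemma nat_closedP (W : Type) (cW : W -> nat -> nat) y :
  closed_code cW -> (forall n, cyl cW (mkseq y n) !=set0) ->
  exists w, cW w = y.
Proof.
move=> cc hy; apply: cc => s; have [w /cyl_mkseq hw] := hy (\max_(i <- s) i).+1.
by exists w => i si; apply: hw; rewrite ltnS; apply: leq_bigmax_seq.
Qed.

Lemma nat_code_cont (W : Type) (IW : countType) (cW : W -> IW -> nat) f :
  code_cont cW c f -> code_cont (nat_code cW) c f.
Proof.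
move=> fc w i; have [s hs] := fc w i.
by exists [seq pickle i | i <- s] => w' /nat_code_agree; apply: hs.
Qed.

(** If the ranges are not separated, repeated splitting into subcylinders yields two branches all of
    whose cylinders have unseparated images. By closedness these branches are the codes of points
    [w1] and [w2]; as [f1 w1] and [f2 w2] differ, a basic set separates the images of small enough
    cylinders. *)
Lemma lusin_separation (W1 W2 : Type) (I1 I2 : countType)
    (c1 : W1 -> I1 -> nat) (c2 : W2 -> I2 -> nat) (f1 : W1 -> X) (f2 : W2 -> X) :
  closed_code c1 -> closed_code c2 -> code_cont c1 c f1 -> code_cont c2 c f2 ->
  (forall w1 w2, f1 w1 <> f2 w2) -> separated c (range f1) (range f2).
Proof.
move=> cc1 cc2 fc1 fc2 f12; apply: contrapT => nsep.
have {cc1}cc1 := nat_code_closed cc1; have {cc2}cc2 := nat_code_closed cc2.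
have {fc1}fc1 := nat_code_cont fc1; have {fc2}fc2 := nat_code_cont fc2.
set d1 := nat_code c1 in cc1 fc1; set d2 := nat_code c2 in cc2 fc2.
pose T (u : seq (nat * nat)) :=
  ~ separated c (f1 @` cyl d1 (unzip1 u)) (f2 @` cyl d2 (unzip2 u)).
have [||y hy] := @tree_branch _ T.
- move=> [P [bP h1 h2]]; apply: nsep; exists P; split=> //.
    by move=> _ [w _ <-]; apply: h1; exists w.
  by move=> _ [w _ <-]; apply: h2; exists w.
- move=> u Tu; apply: contrapT => nk; apply: Tu.
  rewrite cyl_rcons (cyl_rcons d2) !image_bigcup.
  apply: separated_bigcup => i j; apply: contrapT => ns.
  by apply: nk; exists (i, j); rewrite /T /unzip1 /unzip2 !map_rcons.
have E1 n : unzip1 (mkseq y n) = mkseq (fst \o y) n by rewrite /unzip1 -map_comp.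
have E2 n : unzip2 (mkseq y n) = mkseq (snd \o y) n by rewrite /unzip2 -map_comp.
have {}hy n : ~ separated c (f1 @` cyl d1 (mkseq (fst \o y) n))
    (f2 @` cyl d2 (mkseq (snd \o y) n)) by rewrite -E1 -E2; exact: hy.
(* The empty set is separated from everything, so cylinders along the branch are nonempty. *)
have hn n : cyl d1 (mkseq (fst \o y) n) !=set0 /\ cyl d2 (mkseq (snd \o y) n) !=set0.
  split; apply/set0P/eqP => e; apply: (hy n); rewrite e image_set0.
    by exists set0; split=> //; [exact: borel0|by move=> ? _ []].
  exists (~` set0); split=> //; first exact/borelC/borel0.
  by rewrite setC0.
have [w1 hw1] := nat_closedP cc1 (fun n => (hn n).1).
have [w2 hw2] := nat_closedP cc2 (fun n => (hn n).2).
apply: (f12 w1 w2); apply: c_inj; apply/funext => i; apply: contrapT => nci.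
have [s1 hs1] := fc1 w1 i; have [s2 hs2] := fc2 w2 i.
pose n := (\max_(i <- s1 ++ s2) i).+1.
have := hy n; apply.
exists [set x | c x i = c (f1 w1) i]; split.
- exact: borel_basic.
- move=> _ [w /cyl_mkseq hw <-] /=.
  apply: hs1 => j sj; rewrite hw1 hw // ltnS; apply: leq_bigmax_seq => //.
  by rewrite mem_cat sj.
- move=> _ [w /cyl_mkseq hw <-] /=.
  rewrite (hs2 w); first by move/esym.
  move=> j sj; rewrite hw2 hw // ltnS; apply: leq_bigmax_seq => //.
  by rewrite mem_cat sj orbT.
Qed.

End Separation.

(** * Borel rectangles avoiding countably many closed relations *)

Definition closed_rel (X : Type) (I : eqType) (c : X -> I -> nat)
    (K : X -> X -> Prop) :=
  forall x y, (forall s, exists x' y',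
    [/\ K x' y', agree s (c x') (c x) & agree s (c y') (c y)]) -> K x y.

Section Edges.
Variables (X : Type) (I : countType) (c : X -> I -> nat).
Variables (K : nat -> X -> X -> Prop).
Hypothesis K_closed : forall k, closed_rel c (K k).

Section EdgeCode.
Variables (V W : Type) (IV IW : countType).
Variables (cV : V -> IV -> nat) (cW : W -> IW -> nat) (f : V -> X) (g : W -> X).

(** The index k is kept as a coordinate: the union of the relations [K k] need not be closed, but
    their disjoint sum is. *)
Definition edges := {e : nat * V * W | K e.1.1 (f e.1.2) (g e.2)}.

Definition edge_code (e : edges) : unit + IV + IW -> nat :=
  pair_code (pair_code (fun e (_ : unit) => (sval e).1.1)
    (fun e => cV (sval e).1.2)) (fun e => cW (sval e).2) e.

Lemma closed_edge_code : closed_code cV -> closed_code cW ->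
  code_cont cV c f -> code_cont cW c g -> closed_code edge_code.
Proof.
move=> cVc cWc fc gc y hy.
have {hy}hy s t : exists e : edges, [/\ (sval e).1.1 = y (inl (inl tt)),
    agree s (cV (sval e).1.2) (y \o inl \o inr) & agree t (cW (sval e).2) (y \o inr)].
  have [e /agree_pair [/agree_pair [h1 h2] h3]] :=
    hy (map inl (map inl [:: tt] ++ map inr s) ++ map inr t).
  by exists e; split=> //; apply: (h1 tt); rewrite mem_head.
have [v hv] : exists v, cV v = y \o inl \o inr.
  by apply: cVc => s; have [e [_ h _]] := hy s [::]; exists (sval e).1.2.
have [w hw] : exists w, cW w = y \o inr.
  by apply: cWc => s; have [e [_ _ h]] := hy [::] s; exists (sval e).2.
have kvw : K (y (inl (inl tt))) (f v) (g w).
  apply: K_closed => s.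
  have [sv hsv] := code_cont_seq fc v s; have [sw hsw] := code_cont_seq gc w s.
  have [[[[k v'] w'] /= ke] /= [<- h1 h2]] := hy sv sw.
  by exists (f v'), (g w'); split=> //; [apply: hsv; rewrite hv|apply: hsw; rewrite hw].
exists (exist _ (y (inl (inl tt)), v, w) kvw).
apply/funext => -[[[]|i]|i] //=; first by rewrite hv.
by rewrite hw.
Qed.

End EdgeCode.

(** A Borel set is closed for the refined code, hence a continuous image of a space with a closed
    code: Lusin separation applies to it. *)
Lemma borel_code (P : set X) : borel c P -> closed_code c ->
  exists cP : {x | P x} -> I + nat -> nat,
    closed_code cP /\ code_cont cP c sval.
Proof.
move=> [r cr hr] cc; exists (pair_code c r \o sval); split; last first.
  by move=> w i; exists [:: inl i] => w' /(_ _ (mem_head _ _)).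
apply: closed_code_sig; first exact: closed_pair_code.
move=> x hx; have [x' /hr Px' /(_ _ (mem_head _ _)) /= e] := hx [:: inr 0].
by apply/hr; rewrite -e.
Qed.

(* Lusin separation is applied twice: to find P, then to find Q given P. *)
Lemma borel_rectangle (W : Type) (IW : countType) (cW : W -> IW -> nat)
    (f g : W -> X) : injective c -> closed_code c -> closed_code cW ->
  code_cont cW c f -> code_cont cW c g ->
  (forall k w w', ~ K k (f w) (g w')) ->
  exists P Q, [/\ borel c P, borel c Q, forall w, P (f w) /\ Q (g w) &
    forall k x y, P x -> Q y -> ~ K k x y].
Proof.
move=> ci cc cWc fc gc nK.
have idc : code_cont c c id.
  by move=> w i; exists [:: i] => w' /(_ _ (mem_head _ _)).
(* The range of [f] is separated from the points that some [K k] relates to a point of the range of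
   [g]. *)
have [||P [bP fP nP]] := lusin_separation ci cWc
    (closed_edge_code cc cWc idc gc) fc
    (_ : code_cont _ c (fun e : edges id g => (sval e).1.2)).
- by move=> e i; exists [:: inl (inr i)] => e' /(_ _ (mem_head _ _)).
- by move=> w [[[k x] w'] /= kx] xE; apply: (nK k w w'); rewrite xE.
have [cP [cPc svalc]] := borel_code bP cc.
(* The range of [g] is separated from the points to which some [K k] relates a point of [P]. *)
have [||Q [bQ gQ nQ]] := lusin_separation ci cWc
    (closed_edge_code cPc cc svalc idc) gc
    (_ : code_cont _ c (fun e : edges _ id => (sval e).2)).
- by move=> e i; exists [:: inr i] => e' /(_ _ (mem_head _ _)).
- move=> w [[[k [x Px]] y] /= kx] yE.
  apply: (nP x) => //; exists (exist _ (k, x, w) (eq_ind_r (K k x) kx yE)) => //.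
exists P, Q; split=> //.
  by move=> w; split; [apply: fP|apply: gQ]; exists w.
move=> k x y Px Qy kxy; apply: (nQ y) => //.
by exists (exist _ (k, exist _ x Px, y) kxy).
Qed.

End Edges.

(** * The graph G0 *)

Lemma size_words k w : w \in words k -> size w = k.
Proof.
elim: k w => [|k IH] w /=; first by rewrite inE => /eqP ->.
by rewrite mem_cat => /orP[] /mapP [v /IH <- ->].
Qed.

Lemma mem_words w : w \in words (size w).
Proof.
elim: w => [|b w IH] //=; rewrite mem_cat.
by case: b; rewrite map_f ?orbT.
Qed.

Definition word_list n := flatten [seq words k | k <- iota 0 n].

Lemma size_word_list n : n <= size (word_list n).
Proof.
elim: n => // n IH; rewrite /word_list -addn1 iotaD map_cat flatten_cat size_cat.
rewrite leq_add//= cats0; case E: (words n) => //.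
by have := mem_words (nseq n false); rewrite size_nseq E.
Qed.

Lemma nth_word_list m n i : i < size (word_list m) -> m <= n ->
  nth [::] (word_list n) i = nth [::] (word_list m) i.
Proof.
by move=> im /subnKC <-; rewrite /word_list iotaD map_cat flatten_cat nth_cat im.
Qed.

Lemma size_psi n : size (psi n) <= n.
Proof.
have [h|h] := ltnP n (size (word_list n.+1)); last by rewrite /psi nth_default.
have /flattenP [_ /mapP [k + ->] /size_words ->] := mem_nth [::] h.
by rewrite mem_iota add0n ltnS.
Qed.

Lemma psi_surj u : exists n, psi n = u.
Proof.
have uL : u \in word_list (size u).+1.
  apply/flattenP; exists (words (size u)); last exact: mem_words.
  by apply/mapP; exists (size u); rewrite ?mem_iota ?add0n /=.
exists (index u (word_list (size u).+1)); set n := index _ _.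
have nL : n < size (word_list (size u).+1) by rewrite index_mem.
rewrite -[RHS](nth_index [::] uL) -/n /psi -/(word_list n.+1).
(* [psi n] reads the list of words of length at most [n], whereas [u] was found among those of
   length at most [size u]; the shorter list is a prefix of the longer. *)
have [h|h] := leqP n.+1 (size u).+1.
  by rewrite (@nth_word_list n.+1 (size u).+1 n)// size_word_list.
by rewrite (@nth_word_list (size u).+1 n.+1 n)// ltnW.
Qed.

Lemma size_s_ n : size (s_ n) = n.
Proof. by rewrite /s_ size_cat size_nseq subnKC// size_psi. Qed.

Lemma s_dense u : exists n v, s_ n = u ++ v.
Proof. by have [n <-] := psi_surj u; exists n; eexists. Qed.

Lemma prepend_cat u v a : prepend (u ++ v) a = prepend u (prepend v a).
Proof.
apply/funext => i; rewrite /prepend size_cat nth_cat.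
by case: (ltnP i (size u)) => h; [rewrite ltn_addr|rewrite ltn_subLR// subnDA].
Qed.

Definition tail (a : cantor_space) : cantor_space := fun i => a i.+1.

Lemma tail_prepend b a : tail (prepend [:: b] a) = a.
Proof. by apply/funext => i; rewrite /tail /prepend /= subn1. Qed.

Lemma prepend_tail a : prepend [:: a 0] (tail a) = a.
Proof. by apply/funext => -[|i]; rewrite /tail /prepend //= subn1. Qed.

(** The pair is (s_n 0 gamma, s_n 1 gamma), described digit by digit so that limits can be taken
    coordinatewise. *)
Definition edge n (a b : cantor_space) :=
  [/\ forall i, i < n -> a i = nth false (s_ n) i,
      forall i, i < n -> b i = nth false (s_ n) i,
      a n = false, b n = true & forall i, n < i -> a i = b i].

Lemma G0P a b : G0 (a, b) <-> exists n, edge n a b.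
Proof.
split=> [[n [g [-> ->]]]|[n [h1 h2 h3 h4 h5]]]; exists n.
  rewrite /edge /prepend !size_rcons size_s_; split=> [i|i| | |i].
  - by move=> h; rewrite ltnS ltnW// nth_rcons size_s_ h.
  - by move=> h; rewrite ltnS ltnW// nth_rcons size_s_ h.
  - by rewrite ltnSn nth_rcons size_s_ ltnn eqxx.
  - by rewrite ltnSn nth_rcons size_s_ ltnn eqxx.
  - by move=> h; rewrite ltnS leqNgt h.
exists (fun i => a (i + n.+1)); congr pair; apply/funext => i;
  rewrite /prepend size_rcons nth_rcons size_s_ ltnS.
- case: (ltngtP i n) => h; last by rewrite h.
  + by rewrite h1.
  + by rewrite subnK.
- case: (ltngtP i n) => h; last by rewrite h.
  + by rewrite h2.
  + by rewrite subnK// h5.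
Qed.

Lemma edge_neq n a b i : edge n a b -> (a i != b i) = (i == n).
Proof.
move=> [h1 h2 h3 h4 h5]; case: (ltngtP i n) => [h|h|->].
- by rewrite h1 ?h2 ?eqxx.
- by rewrite h5 ?eqxx.
- by rewrite h3 h4.
Qed.

Lemma T0P x y : T0 (x, y) <-> y 0 = ~~ x 0 /\ G0 (tail x, tail y).
Proof.
split=> [[e [a [b [h [-> ->]]]]]|[h1 h2]]; first by rewrite !tail_prepend.
by exists (x 0), (tail x), (tail y); split=> //; rewrite -h1 !prepend_tail.
Qed.

Definition cantor_code (a : cantor_space) (i : nat) : nat := a i.

Lemma cantor_codeE a b i : cantor_code a i = cantor_code b i <-> a i = b i.
Proof. by rewrite /cantor_code; case: (a i); case: (b i). Qed.

Lemma cantor_code_nbhs (a : cantor_space) V :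
  code_open cantor_code V a -> nbhs a V.
Proof.
move=> [s hs]; suff : nbhs a [set b | agree s (cantor_code a) (cantor_code b)].
  exact: filterS.
elim: s {hs} => [|i s IH]; first by apply: filterS filterT.
have hi : nbhs a [set b : cantor_space | b i = a i].
  have /(_ [set a i]) := @proj_continuous nat (fun=> bool) i a; apply.
  exact: discrete_set1.
apply: filterS2 hi IH => b /= hi hs j; rewrite inE => /predU1P[->|]; last exact: hs.
by apply/cantor_codeE.
Qed.

Lemma edge_closed n a b : (forall s, exists a' b', [/\ edge n a' b',
    agree s (cantor_code a') (cantor_code a) &
    agree s (cantor_code b') (cantor_code b)]) -> edge n a b.
Proof.
move=> h.
have {}h i : exists a' b', [/\ edge n a' b', a' i = a i, b' i = b i,
    a' n = a n & b' n = b n].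
  have [a' [b' [e ha hb]]] := h [:: i; n]; exists a', b'.
  by split=> //; apply/cantor_codeE; (apply: ha || apply: hb);
    rewrite !inE eqxx ?orbT.
split=> [i hi|i hi| | |i hi].
- by have [a' [b' [[+ _ _ _ _] <- _ _ _]]] := h i; apply.
- by have [a' [b' [[_ + _ _ _] _ <- _ _]]] := h i; apply.
- by have [a' [b' [[_ _ + _ _] <- _ _ _]]] := h n.
- by have [a' [b' [[_ _ _ + _] _ <- _ _]]] := h n.
- by have [a' [b' [[_ _ _ _ +] <- <- _ _]]] := h i; apply.
Qed.

(** If the tails differ at digit [i], close enough pairs of [T0] have tails differing at [i], hence
    forming edges at s_i; for fixed [i] these edges form a closed set. *)
Lemma T0_closure x y : (forall s, exists x' y', [/\ T0 (x', y'),
    agree s (cantor_code x') (cantor_code x) &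
    agree s (cantor_code y') (cantor_code y)]) ->
  T0 (x, y) \/ (y 0 = ~~ x 0 /\ tail x = tail y).
Proof.
move=> h.
have y0 : y 0 = ~~ x 0.
  have [x' [y' [/T0P [e _] hx hy]]] := h [:: 0].
  have -> : x 0 = x' 0 by apply/cantor_codeE; rewrite hx ?mem_head.
  by rewrite -e; apply/cantor_codeE; rewrite hy ?mem_head.
have [e|ne] := pselect (tail x = tail y); first by right.
left; apply/T0P; split=> //.
have [i xyi] : exists i, tail x i <> tail y i.
  apply: contrapT => /forallNP ni; apply: ne; apply/funext => i.
  by apply: contrapT => ?; apply: (ni i).
apply/G0P; exists i; apply: edge_closed => s.
have [x' [y' [/T0P [_ /G0P [n e]] hx hy]]] := h (map succn (i :: s)).
have tE j : j \in i :: s -> tail x' j = tail x j /\ tail y' j = tail y j.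
  by move=> js; split; apply/cantor_codeE; [apply: hx|apply: hy]; apply: map_f.
have ni : i = n.
  apply/eqP; rewrite -(edge_neq i e); have [-> ->] := tE i (mem_head _ _).
  exact/eqP.
subst n.
exists (tail x'), (tail y'); split=> // j js; apply/cantor_codeE.
  by have [] := tE j; rewrite // inE js orbT.
by have [] := tE j; rewrite // inE js orbT.
Qed.

(** * Baire category *)

Definition bool_cyl (u : seq bool) : set cantor_space :=
  [set x | forall i, i < size u -> x i = nth false u i].

Lemma cyl2_cat u v x : bool_cyl (u ++ v) x -> bool_cyl u x.
Proof. by move=> h i hi; rewrite h ?nth_cat ?hi// size_cat ltn_addr. Qed.

Lemma cyl2_mkseq (x : cantor_space) n : bool_cyl (mkseq x n) x.
Proof. by move=> i; rewrite size_mkseq => h; rewrite nth_mkseq. Qed.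

Lemma cyl2_extend u x n : bool_cyl u x -> size u <= n ->
  exists v, mkseq x n = u ++ v.
Proof.
move=> h un; exists (drop (size u) (mkseq x n)).
rewrite -[LHS](cat_take_drop (size u)); congr (_ ++ _).
apply: (@eq_from_nth _ false) => [|i]; rewrite size_takel ?size_mkseq// => hi.
by rewrite nth_take// nth_mkseq ?h// (leq_trans hi).
Qed.

Lemma cyl2_prepend u v x : bool_cyl v x -> bool_cyl (u ++ v) (prepend u x).
Proof.
move=> h i; rewrite size_cat /prepend nth_cat => hi.
by case: ltnP => // ui; apply: h; rewrite ltn_subLR.
Qed.

Definition nowhere_dense (F : set cantor_space) :=
  forall u, exists v, bool_cyl (u ++ v) `<=` ~` F.

Definition meager (M : set cantor_space) :=
  exists2 F : nat -> set cantor_space,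
    forall i, nowhere_dense (F i) & M `<=` \bigcup_i F i.

Lemma meagerS M N : M `<=` N -> meager N -> meager M.
Proof. by move=> MN [F h1 h2]; exists F => //; apply: subset_trans h2. Qed.

Lemma nowhere_dense0 : nowhere_dense set0.
Proof. by move=> u; exists [::] => x _ []. Qed.

Lemma nowhere_dense_meager F : nowhere_dense F -> meager F.
Proof. by move=> h; exists (fun=> F) => // x Fx; exists 0. Qed.

Lemma meager_bigcup (T : countType) (M : T -> set cantor_space) :
  (forall t, meager (M t)) -> meager (\bigcup_t M t).
Proof.
move=> h.
have [t|F hF] := @choice T (nat -> set cantor_space) (fun t F =>
    (forall i, nowhere_dense (F i)) /\ M t `<=` \bigcup_i F i).
  by have [F ? ?] := h t; exists F.
exists (fun n => if pickle_inv n is Some (t, i) then F t i else set0).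
  by move=> n; case: pickle_inv => [[t i]|]; [apply: (hF t).1|exact: nowhere_dense0].
move=> x [t _ /(hF t).2 [i _ Fx]].
by exists (pickle (t, i)) => //; rewrite pickleK_inv.
Qed.

Lemma meagerU M N : meager M -> meager N -> meager (M `|` N).
Proof.
move=> hM hN; apply: (@meagerS _ (\bigcup_(b : bool) if b then M else N)).
  by move=> x [Mx|Nx]; [exists true|exists false].
by apply: meager_bigcup => -[].
Qed.

Lemma baire M u : meager M -> exists2 x, bool_cyl u x & ~ M x.
Proof.
move=> [F nF MF].
have [p|g hg] := @choice (nat * seq bool) (seq bool)
  (fun p v => bool_cyl (p.2 ++ v) `<=` ~` F p.1); first exact: nF.
(* The letter [false] makes the words grow even when [g] returns the empty word, so that they
   determine a point. *)
pose st := fix st n := if n is k.+1 then st k ++ g (k, st k) ++ [:: false] else u.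
have stD m n : exists v, st (m + n) = st m ++ v.
  elim: n => [|n [v hv]]; first by exists [::]; rewrite addn0 cats0.
  by rewrite addnS /= hv -catA; eexists.
have sz n : n <= size (st n).
  elim: n => // n IH; rewrite /= !size_cat /= addnA addn1 ltnS.
  by rewrite (leq_trans IH)// leq_addr.
pose x : cantor_space := fun i => nth false (st i.+1) i.
have xst n : bool_cyl (st n) x.
  move=> i hi; rewrite /x; have [v hv] := stD i.+1 n; have [w hw] := stD n i.+1.
  rewrite addnC hw in hv.
  have := congr1 (fun s => nth false s i) hv; rewrite !nth_cat hi => ->.
  by rewrite (sz i.+1).
exists x; first exact: (xst 0).
move=> /MF [i _]; apply: (hg (i, st i)) => /=.
apply: (@cyl2_cat _ [:: false]); rewrite -catA; exact: (xst i.+1).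
Qed.

Lemma meager_prepend w M : meager M -> meager [set a | M (prepend w a)].
Proof.
move=> [F nF MF]; exists (fun i => [set a | F i (prepend w a)]); last first.
  by move=> a /MF [i _ Fi]; exists i.
move=> i u; have [v hv] := nF i (w ++ u); exists v => a /= ha.
by apply: hv; rewrite -catA; apply: cyl2_prepend.
Qed.

(** * Category and maps with closed graph *)

Section ClosedGraph.
Variable k : cantor_space -> nat -> nat.
Hypothesis k_closed : closed_graph cantor_code k.

Let B w := cyl k w.
Let large w u := ~ meager (B w `&` bool_cyl u).
(** The closed set of points near which [B w] is everywhere non-meager. *)
Let hull w : set cantor_space := [set x | forall n, large w (mkseq x n)].

Lemma meager_hull w : meager (B w `\` hull w).
Proof.
apply: (@meagerS _ (\bigcup_u if `[< large w u >] then set0 else B w `&` bool_cyl u)).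
  move=> x [Bx /existsNP [n hn]]; exists (mkseq x n) => //.
  by case: asboolP => // _; split=> //; exact: cyl2_mkseq.
apply: meager_bigcup => u; case: asboolP => [_|/contrapT//].
exact/nowhere_dense_meager/nowhere_dense0.
Qed.

(** Being closed, [hull w] would otherwise be nowhere dense in the cylinder of [u], and [B w] would
    be meager there by [meager_hull]. *)
Lemma large_hull w u : large w u -> exists v, bool_cyl (u ++ v) `<=` hull w.
Proof.
move=> lwu; apply: contrapT => /forallNP nv; apply: lwu.
apply: (@meagerS _ ((B w `\` hull w) `|` (hull w `&` bool_cyl u))).
  move=> x [Bx ux]; have [hx|nx] := pselect (hull w x); first by right.
  by left.
apply: meagerU; first exact: meager_hull.
apply: nowhere_dense_meager => u0.
have [[x [x0 xu]]|nx] := pselect (exists x, bool_cyl u0 x /\ bool_cyl u x); last first.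
  exists [::] => x; rewrite cats0 => x0 [_ xu]; apply: nx; by exists x.
have [v0 E0] := cyl2_extend x0 (leq_maxl (size u0) (size u)).
have [v E] := cyl2_extend xu (leq_maxr (size u0) (size u)).
have /existsNP [z /not_implyP [vz /existsNP [n nl]]] := nv v.
(* This prefix of [z] extends both [u ++ v] and the prefix of length [n], at which largeness fails;
   so largeness fails here too. *)
have [v' E'] := cyl2_extend vz (leq_addr n _).
exists (v0 ++ v'); rewrite catA -E0 E -E' => z' hz' [/(_ (size (u ++ v) + n)) l' _].
apply: l'; apply: meagerS (contrapT nl) => y [By yz]; split=> //.
move=> i; rewrite size_mkseq => hi; rewrite nth_mkseq//.
have im : i < size (u ++ v) + n by rewrite ltn_addl.
by rewrite yz ?size_mkseq// nth_mkseq// hz' ?size_mkseq// nth_mkseq.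
Qed.

(** The argument by which the Souslin operation preserves the Baire property. The points of
    [hull w'] lying in no [hull (rcons w' n)] form a nowhere dense set [D w']. Off all these sets, a
    point [x] of the cylinder of [v] follows a branch of hulls; the sets [B] along the branch
    accumulate at [x], so the closed graph makes [k x] this branch, which starts with [w]. *)
Lemma comeager_cyl w : ~ meager (B w) -> exists u, meager (bool_cyl u `\` B w).
Proof.
move=> nB; have [|v hv] := @large_hull w [::].
  by apply: contra_not nB => /meagerS; apply => x Bx; split.
exists v.
pose D w' := hull w' `\` \bigcup_n hull (rcons w' n).
apply: (@meagerS _ (\bigcup_w' D w')); last first.
  apply: meager_bigcup => w'; apply: nowhere_dense_meager => u.
  have [l|/contrapT nl] := pselect (large w' u); last first.
    exists [::] => x; rewrite cats0 => xu [/(_ (size u))]; case.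
    have [v' E] := cyl2_extend xu (leqnn _).
    apply: meagerS nl => y [By]; rewrite E => /cyl2_cat; by split.
  have [n ln] : exists n, large (rcons w' n) u.
    apply: contrapT => /forallNP nn; apply: l; rewrite /B cyl_rcons setI_bigcupl.
    by apply: meager_bigcup => n; apply: contrapT; apply: nn.
  have [v' hv'] := large_hull ln.
  by exists v' => x /hv' hx [_]; apply; exists n.
move=> x [vx nBx]; apply: contrapT => nD.
have [||y hy] := @tree_branch nat (fun z => hull (w ++ z) x).
- by rewrite cats0; apply: hv.
- move=> z hz; apply: contrapT => nz; apply: nD; exists (w ++ z) => //.
  by split=> // -[n _]; rewrite rcons_cat => hn; apply: nz; exists n.
pose y' i := nth 0 (w ++ mkseq y i.+1) i.
have ky : k x = y'.
  apply: k_closed => s t.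
  have [z [Bz xz]] : (B (w ++ mkseq y (\max_(i <- t) i).+1) `&`
      bool_cyl (mkseq x (\max_(i <- s) i).+1)) !=set0.
    apply/set0P/eqP => e; apply: (hy (\max_(i <- t) i).+1 (\max_(i <- s) i).+1).
    by rewrite e; apply/nowhere_dense_meager/nowhere_dense0.
  exists z => i si.
    apply/cantor_codeE; rewrite xz ?size_mkseq ?nth_mkseq// ltnS;
    exact: leq_bigmax_seq.
  rewrite Bz.
    rewrite /y' !nth_cat; case: ltnP => // h; rewrite !nth_mkseq//.
      by rewrite ltnS leq_subr.
    by rewrite ltnS (leq_trans (leq_subr _ _))//; apply: leq_bigmax_seq.
  rewrite size_cat size_mkseq addnS ltnS.
  by rewrite (@leq_trans (\max_(i <- t) i)) ?leq_addl//; apply: leq_bigmax_seq.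
apply: nBx => i iw; rewrite ky /y' nth_cat iw //.
Qed.

(** One of the countably many edge-free sets [B w] is non-meager, hence comeager in the cylinder of
    some [u]. Some [s_ n] extends [u], and for generic [a] both s_n 0 a and s_n 1 a are in [B w]. *)
Lemma no_independent_cyl_cover : (forall x, exists n, forall a b,
    B (mkseq (k x) n) a -> B (mkseq (k x) n) b -> ~ G0 (a, b)) -> False.
Proof.
move=> h.
pose ind w := forall a b, B w a -> B w b -> ~ G0 (a, b).
have [w [iw nm]] : exists w, ind w /\ ~ meager (B w).
  apply: contrapT => /forallNP nw.
  have [|x _] := @baire (\bigcup_w if `[< ind w >] then B w else set0) [::].
    apply: meager_bigcup => w; case: asboolP => iw; last first.
      exact/nowhere_dense_meager/nowhere_dense0.
    by apply: contrapT => nm; apply: (nw w).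
  apply; have [n hn] := h x; exists (mkseq (k x) n) => //.
  case: asboolP => // _ i; rewrite size_mkseq => ?; by rewrite nth_mkseq.
have [u hu] := comeager_cyl nm.
have [n [v hn]] := s_dense u.
have [|a _ na] := @baire ([set a | (bool_cyl u `\` B w) (prepend (rcons (s_ n) false) a)]
   `|` [set a | (bool_cyl u `\` B w) (prepend (rcons (s_ n) true) a)]) [::].
  by apply: meagerU; apply: meager_prepend.
have hb b : bool_cyl u (prepend (rcons (s_ n) b) a).
  apply: (@cyl2_cat _ (v ++ [:: b])); rewrite catA -hn cats1.
  by rewrite -[X in bool_cyl X]cats0; apply: cyl2_prepend.
apply: (iw (prepend (rcons (s_ n) false) a) (prepend (rcons (s_ n) true) a)).
- by apply: contrapT => nB; apply: na; left; split.
- by apply: contrapT => nB; apply: na; right; split.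
- by exists n, a.
Qed.

End ClosedGraph.

Section ClosedGraphs.
Variables (X : Type) (I : countType) (c : X -> I -> nat).

Lemma closed_graph_pair (J J' : eqType) (r : X -> J -> nat) (r' : X -> J' -> nat) :
  closed_graph c r -> closed_graph c r' -> closed_graph c (pair_code r r').
Proof.
move=> hr hr' x y hy; apply/funext => -[j|j] /=.
  suff -> : r x = y \o inl by [].
  by apply: hr => s t; 
    have [x' h /agree_pair [? _]] := hy s (map inl t ++ map inr [::]); exists x'.
suff -> : r' x = y \o inr by [].
by apply: hr' => s t; 
  have [x' h /agree_pair [_ ?]] := hy s (map inl [::] ++ map inr t); exists x'.
Qed.

Lemma closed_graph_family (J : eqType) (r : nat -> X -> J -> nat) :
  (forall i, closed_graph c (r i)) ->
  closed_graph c (fun x (p : nat * J) => r p.1 x p.2).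
Proof.
move=> hr x y hy; apply/funext => -[i j] /=.
suff -> : r i x = fun j => y (i, j) by [].
apply: hr => s t; have [x' h k] := hy s [seq (i, j) | j <- t].
by exists x' => // j' tj; rewrite -(k (i, j')) ?map_f.
Qed.

Lemma borel_family (P : nat -> set X) : (forall i, borel c (P i)) ->
  exists2 r : X -> nat * nat -> nat, closed_graph c r &
    forall i x, P i x <-> r x (i, 0) <> 0.
Proof.
move=> bP.
have [i|r hr] := @choice nat (X -> nat -> nat)
    (fun i r => closed_graph c r /\ forall x, P i x <-> r x 0 <> 0).
  by have [r ? ?] := bP i; exists r.
exists (fun x p => r p.1 x p.2); last by move=> i x; exact: (hr i).2.
by apply: closed_graph_family => i; exact: (hr i).1.
Qed.

End ClosedGraphs.

(** * Potential closedness, and its failure for [T0] *)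

Lemma closed_graph_prepend (I : countType) (c : cantor_space -> I -> nat) b :
  closed_code c ->
  (forall x V, code_open cantor_code V x -> code_open c V x) ->
  closed_graph cantor_code (fun a => c (prepend [:: b] a)).
Proof.
move=> cc co x y hy.
have [|z hz] := cc y.
  by move=> s; have [x' _ h] := hy [::] s; exists (prepend [:: b] x').
suff -> : prepend [:: b] x = z by [].
(* The points [prepend [:: b] x'] tend to [z] for [c], hence in the Cantor space, while [x'] tends
   to [x]: the digits of the two limits coincide. *)
apply/funext => i.
have [|t ht] := co z [set z' | z' i = z i].
  by exists [:: i] => z' /(_ i (mem_head _ _)) /cantor_codeE.
have [x' hx' hc] := hy (iota 0 i) t.
have <- : prepend [:: b] x' i = z i.
  by apply: ht; rewrite hz; apply: agree_sym.
case: i hx' {ht} => [//|i] hx'; rewrite /prepend /= subn1 /=.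
by apply/esym/cantor_codeE; apply: hx'; rewrite mem_iota add0n ltnS leqnn.
Qed.

Lemma finer_code (X : topologicalType) (I : eqType) (sigma : Topological X)
    (c : X -> I -> nat) : finer sigma ->
  (forall (x : X) V, @nbhs _ (retopologize sigma) x V -> code_open c V x) ->
  forall (x : X) V, nbhs x V -> code_open c V x.
Proof.
move=> fs co x V; rewrite nbhsE => -[B [oB Bx] BV]; apply: co.
by rewrite nbhsE; exists B => //; split=> //; apply: fs.
Qed.

Lemma T0_not_pot_closed (R : realType) : ~ pot_closed R T0.
Proof.
move=> [sigma [tau [fs ps ft pt cl]]].
have [c1 [cc1 co1]] := polish_code ps; have [c2 [cc2 co2]] := polish_code pt.
pose r := pair_code (fun a => c1 (prepend [:: false] a))
                    (fun a => c2 (prepend [:: true] a)).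
have hr : closed_graph cantor_code (nat_code r).
  apply: closed_graph_nat_code; apply: closed_graph_pair.
    apply: closed_graph_prepend => // x V /cantor_code_nbhs.
    exact: (finer_code fs co1).
  apply: closed_graph_prepend => // x V /cantor_code_nbhs.
  exact: (finer_code ft co2).
apply: (no_independent_cyl_cover hr) => x.
(* No edge is a loop, so (0x, 1x) is outside [T0]. A basic rectangle around it missing [T0] involves
   finitely many coordinates, which yields a cylinder of [r] without edges. *)
pose p : retopologize sigma * retopologize tau :=
  (prepend [:: false] x, prepend [:: true] x).
have : nbhs p (~` T0).
  apply: open_nbhs_nbhs; split; first exact: closed_openC.
  move=> /T0P [_]; rewrite !tail_prepend => /G0P [n e].
  by have := edge_neq n e; rewrite !eqxx.
case=> -[U V] /= [/co1 [s hs] /co2 [t ht]] UV.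
pose l := [seq pickle i | i <- map inl s ++ map inr t : seq ((nat + nat) + (nat + nat))].
exists (\max_(i <- l) i).+1 => a b ha hb ab.
have hl a' : cyl (nat_code r) (mkseq (nat_code r x) (\max_(i <- l) i).+1) a' ->
    agree s (c1 (prepend [:: false] x)) (c1 (prepend [:: false] a')) /\
    agree t (c2 (prepend [:: true] x)) (c2 (prepend [:: true] a')).
  move=> /cyl_mkseq h.
  have /nat_code_agree/agree_pair // : agree l (nat_code r x) (nat_code r a').
  by move=> i il; rewrite h // ltnS; apply: leq_bigmax_seq.
apply: (UV (prepend [:: false] a, prepend [:: true] b)).
  by split; [apply: hs; exact: (hl a ha).1|apply: ht; exact: (hl b hb).2].
by apply/T0P; rewrite !tail_prepend.
Qed.

(** The topology coded by [c] serves on both sides of the product. *)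
Lemma code_pot_closed (R : realType) (X : topologicalType) (I : countType)
    (c : X -> I -> nat) (S : set (X * X)) : closed_code c -> injective c ->
  (forall (x : X) V, nbhs x V -> code_open c V x) ->
  (forall x y, ~ S (x, y) -> exists s, forall x' y',
    agree s (c x) (c x') -> agree s (c y) (c y') -> ~ S (x', y')) ->
  pot_closed R S.
Proof.
move=> cc ci co cS; have [sigma [ps ns]] := code_polish R cc ci.
have fs : finer sigma.
  move=> U oU; rewrite openE => x Ux; apply/ns/co; exact: open_nbhs_nbhs.
exists sigma, sigma; split=> //.
rewrite -[S]setCK; apply: open_closedC; rewrite openE => -[x y] /cS [s hs].
exists ([set x' | agree s (c x) (c x')], [set y' | agree s (c y) (c y')]).
  by split; apply/ns; exists s.
by move=> [x' y'] [/= h1 h2]; apply: hs.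
Qed.

(** * Twins and small sets *)

Lemma closed_code_prod (X Y : Type) (I J : eqType) (c : X -> I -> nat)
    (d : Y -> J -> nat) : closed_code c -> closed_code d ->
  closed_code (pair_code (fun z : X * Y => c z.1) (fun z => d z.2)).
Proof.
move=> cc dc y hy.
have {}hy s t : exists z : X * Y, agree s (c z.1) (y \o inl) /\ agree t (d z.2) (y \o inr).
  by have [z /agree_pair h] := hy (map inl s ++ map inr t); exists z.
have [|x hx] := cc (y \o inl).
  by move=> s; have [z [h _]] := hy s [::]; exists z.1.
have [|x' hx'] := dc (y \o inr).
  by move=> s; have [z [_ h]] := hy [::] s; exists z.2.
by exists (x, x'); apply/funext => -[i|i] /=; rewrite ?hx ?hx'.
Qed.

Lemma closed_code_fun (T I : eqType) (W : Type) (c : W -> I -> nat) :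
  closed_code c -> closed_code (fun (x : T -> W) (p : T * I) => c (x p.1) p.2).
Proof.
move=> cc y hy.
have [t|x hx] := @choice T W (fun t w => c w = fun i => y (t, i)).
  apply: cc => s; have [x h] := hy [seq (t, i) | i <- s].
  by exists (x t) => i si; apply: (h (t, i)); apply: map_f.
by exists x; apply/funext => -[t i] /=; rewrite hx.
Qed.

Section Reduction.
Variables (X : Type) (I : countType) (c : X -> I -> nat).
Variables (f : X -> cantor_space) (d : nat -> I).
Hypotheses (c_closed : closed_code c) (f_inj : injective f).
(* The digits of [f x] are among the coordinates of the code of [x]. *)
Hypothesis c_digit : forall x j, c x (d j) = cantor_code (f x) j.

Lemma digit_code_inj : injective c.
Proof.
move=> x y e; apply: f_inj; apply/funext => j; apply/cantor_codeE.
by rewrite -!c_digit e.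
Qed.

Lemma agree_digits x x' s : agree (map d s) (c x) (c x') ->
  agree s (cantor_code (f x)) (cantor_code (f x')).
Proof. by move=> h i si; rewrite -!c_digit h ?map_f. Qed.

Lemma agree_tail_digits x x' s : agree (map (d \o succn) s) (c x) (c x') ->
  agree s (cantor_code (tail (f x))) (cantor_code (tail (f x'))).
Proof.
move=> h i si; have /= := h (d i.+1); rewrite !c_digit; apply.
exact: (map_f (d \o succn)).
Qed.

(* Even indices list the edges from [x] to [y], odd ones those from [y] to
   [x]. *)
Definition link (k : nat) (x y : X) : Prop :=
  [/\ f x 0 = false, f y 0 = true &
    if odd k then edge k./2 (tail (f y)) (tail (f x))
    else edge k./2 (tail (f x)) (tail (f y))].

Lemma link_closed k : closed_rel c (link k).
Proof.
move=> x y hK.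
have h s : exists x' y', [/\ link k x' y',
    agree s (cantor_code (tail (f x'))) (cantor_code (tail (f x))),
    agree s (cantor_code (tail (f y'))) (cantor_code (tail (f y))),
    f x 0 = f x' 0 & f y 0 = f y' 0].
  have [x' [y' [kxy hx hy]]] := hK (d 0 :: map (d \o succn) s).
  exists x', y'; split=> //.
  - by apply: agree_tail_digits => i si; apply: hx; rewrite inE si orbT.
  - by apply: agree_tail_digits => i si; apply: hy; rewrite inE si orbT.
  - by apply/cantor_codeE; rewrite -!c_digit hx ?mem_head.
  - by apply/cantor_codeE; rewrite -!c_digit hy ?mem_head.
split.
- by have [x' [y' [[<- _ _] _ _ ->]]] := h [::].
- by have [x' [y' [[_ <- _] _ _ _ ->]]] := h [::].
case ok: (odd k); apply: edge_closed => s;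
  have [x' [y' [[_ _]]]] := h s; rewrite ok => e hx hy _ _.
  by exists (tail (f y')), (tail (f x')).
by exists (tail (f x')), (tail (f y')).
Qed.

Definition twins := {z : X * X |
  [/\ f z.1 0 = false, f z.2 0 = true & tail (f z.1) = tail (f z.2)]}.

Definition fst_twin (z : twins) : X := (sval z).1.
Definition snd_twin (z : twins) : X := (sval z).2.
Definition base (z : twins) : cantor_space := tail (f (fst_twin z)).

Lemma base_snd z : tail (f (snd_twin z)) = base z.
Proof. by case: z => z []. Qed.

(** The code [e] is a parameter because twins are coded both by [c] and by refinements of [c]. *)
Definition twin_code (J : Type) (e : X -> J -> nat) (z : twins) : J + J -> nat :=
  pair_code (fun z => e (fst_twin z)) (fun z => e (snd_twin z)) z.

Lemma closed_twin_code : closed_code (twin_code c).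
Proof.
apply: (@closed_code_sig _ _ (pair_code (fun z : X * X => c z.1)
  (fun z => c z.2))); first exact: closed_code_prod.
move=> [x y] h; rewrite /=.
have {}h s : exists x' y', [/\ f x' 0 = false, f y' 0 = true, tail (f x') = tail (f y'),
    agree s (cantor_code (f x)) (cantor_code (f x')) &
    agree s (cantor_code (f y)) (cantor_code (f y'))].
  have [[x' y'] [h1 h2 h3]] := h (map inl (map d s) ++ map inr (map d s)).
  move=> /(agree_pair (fun z : X * X => c z.1) (fun z => c z.2)) [hx hy].
  by exists x', y'; split=> //; apply: agree_digits; exact: agree_sym.
split.
- have [x' [y' [h1 h2 h3 hx hy]]] := h [:: 0].
  by rewrite -h1; apply/cantor_codeE; apply: hx; rewrite mem_head.
- have [x' [y' [h1 h2 h3 hx hy]]] := h [:: 0].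
  by rewrite -h2; apply/cantor_codeE; apply: hy; rewrite mem_head.
- apply/funext => i; have [x' [y' [h1 h2 h3 hx hy]]] := h [:: i.+1].
  have /cantor_codeE := hx _ (mem_head _ _); have /cantor_codeE := hy _ (mem_head _ _).
  by rewrite /tail => -> ->; exact: (congr1 (fun g => g i) h3).
Qed.

Definition small (A : set twins) := exists P Q : nat -> set X,
  [/\ forall i, borel c (P i) /\ borel c (Q i),
      forall i k x y, P i x -> Q i y -> ~ link k x y &
      A `<=` [set z | exists i, P i (fst_twin z) /\ Q i (snd_twin z)]].

Lemma smallS A A' : A `<=` A' -> small A' -> small A.
Proof. by move=> AA' [P [Q [h1 h2 h3]]]; exists P, Q; split=> // z /AA'/h3. Qed.

Lemma small_rect P Q (A : set twins) : borel c P -> borel c Q ->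
  (forall k x y, P x -> Q y -> ~ link k x y) ->
  (forall z, A z -> P (fst_twin z) /\ Q (snd_twin z)) -> small A.
Proof.
move=> bP bQ h AP; exists (fun=> P), (fun=> Q); split=> // z /AP ?.
by exists 0.
Qed.

Lemma small0 : small set0.
Proof. by apply: (@small_rect set0 set0) => //; apply: borel0. Qed.

Lemma small_bigcup (T : countType) (A : T -> set twins) :
  (forall t, small (A t)) -> small (\bigcup_t A t).
Proof.
move=> h.
have [t|PQ hPQ] := @choice T ((nat -> set X) * (nat -> set X)) (fun t PQ =>
  [/\ forall i, borel c (PQ.1 i) /\ borel c (PQ.2 i),
      forall i k x y, PQ.1 i x -> PQ.2 i y -> ~ link k x y &
      A t `<=` [set z | exists i, PQ.1 i (fst_twin z) /\ PQ.2 i (snd_twin z)]]).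
  by have [P [Q ?]] := h t; exists (P, Q).
exists (fun n => if pickle_inv n is Some (t, i) then (PQ t).1 i else set0).
exists (fun n => if pickle_inv n is Some (t, i) then (PQ t).2 i else set0).
split.
- move=> n; case: pickle_inv => [[t i]|]; first by case: (hPQ t).
  by split; apply: borel0.
- by move=> n; case: pickle_inv => [[t i]|//]; have [_ + _] := hPQ t; apply.
- move=> z [t _]; have [_ _ /[apply]] := hPQ t => -[i hi].
  by exists (pickle (t, i)); rewrite pickleK_inv.
Qed.

Lemma smallU A A' : small A -> small A' -> small (A `|` A').
Proof.
move=> h h'; apply: (@smallS _ (\bigcup_(b : bool) if b then A else A')).
  by move=> x [Ax|Ax]; [exists true|exists false].
by apply: small_bigcup => -[].
Qed.

(* Off the twins, non-membership in S is decided by finitely many digits of f. *)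
Lemma small_code : small setT -> exists (J : countType) (e : X -> J -> nat),
  [/\ closed_code e, injective e, forall V x, code_open c V x -> code_open e V x &
   forall x y, ~ T0 (f x, f y) -> exists s, forall x' y',
     agree s (e x) (e x') -> agree s (e y) (e y') -> ~ T0 (f x', f y')].
Proof.
move=> [P [Q [bPQ nPQ cov]]].
have [rP crP hP] := borel_family (fun i => (bPQ i).1).
have [rQ crQ hQ] := borel_family (fun i => (bPQ i).2).
(* The additional coordinates make all [P i] and [Q i] clopen. *)
pose e := pair_code c (pair_code rP rQ).
have ec : closed_code e.
  by apply: closed_pair_code => //; apply: closed_graph_pair.
have eP x x' i : e x (inr (inl (i, 0))) = e x' (inr (inl (i, 0))) -> P i x -> P i x'.
  by move=> /= E /hP Px; apply/hP; rewrite -E.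
have eQ x x' i : e x (inr (inr (i, 0))) = e x' (inr (inr (i, 0))) -> Q i x -> Q i x'.
  by move=> /= E /hQ Qx; apply/hQ; rewrite -E.
have T0link x y : T0 (f x, f y) ->
    (f x 0 = false /\ exists k, link k x y) \/ (f x 0 = true /\ exists k, link k y x).
  move=> /T0P [fxy /G0P [n en]]; case fx: (f x 0); rewrite fx in fxy.
    by right; split=> //; exists n.*2.+1; split; rewrite //= ?odd_double ?uphalf_double.
  by left; split=> //; exists n.*2; split; rewrite // ?odd_double ?doubleK.
exists _, e; split=> //.
- by move=> x y exy; apply: digit_code_inj; apply/funext => i;
  have := congr1 (@^~ (inl i)) exy.
- move=> V x [s hs]; exists (map inl s ++ map inr [::]) => x' /agree_pair [h _]; exact: hs.
- move=> x y nT.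
  have [[fy0 xy]|ntw] := pselect (f y 0 = ~~ f x 0 /\ tail (f x) = tail (f y)); last first.
    apply: contrapT => /forallNP hs.
    have [|//|//] := @T0_closure (f x) (f y).
    move=> s; have := hs (map inl (map d s)) => /existsNP [x' /existsNP [y']].
    move=> /not_implyP [hx /not_implyP [hy /contrapT t]].
    exists (f x'), (f y'); split=> //; apply: agree_digits => i si; apply/esym.
      by apply: (hx (inl i)); apply: map_f.
    by apply: (hy (inl i)); apply: map_f.
  case fx: (f x 0); rewrite fx in fy0.
    have tw : [/\ f (y, x).1 0 = false, f (y, x).2 0 = true &
        tail (f (y, x).1) = tail (f (y, x).2)] by [].
    have [i /= [Py Qx]] := cov (exist _ (y, x) tw) Logic.I.
    (* Coordinate [d 0] fixes the first digit, hence the orientation; the two others keep the pair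
       inside a rectangle without links. *)
    exists [:: inl (d 0); inr (inl (i, 0)); inr (inr (i, 0))] => x' y' hx hy /T0link.
    have fx' : f x' 0 = f x 0.
      apply/cantor_codeE; rewrite -!c_digit; apply/esym.
      exact: (hx (inl (d 0)) (mem_head _ _)).
    rewrite fx' fx => -[[//]|[_ [k]]]; apply: (nPQ i).
      by apply: (eP y) => //; apply: hy; rewrite !inE eqxx ?orbT.
    by apply: (eQ x) => //; apply: hx; rewrite !inE eqxx ?orbT.
  have tw : [/\ f (x, y).1 0 = false, f (x, y).2 0 = true &
      tail (f (x, y).1) = tail (f (x, y).2)] by [].
  have [i /= [Px Qy]] := cov (exist _ (x, y) tw) Logic.I.
  exists [:: inl (d 0); inr (inl (i, 0)); inr (inr (i, 0))] => x' y' hx hy /T0link.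
  have fx' : f x' 0 = f x 0.
    apply/cantor_codeE; rewrite -!c_digit; apply/esym.
      exact: (hx (inl (d 0)) (mem_head _ _)).
  rewrite fx' fx => -[[_ [k]]|[//]]; apply: (nPQ i).
    by apply: (eP x) => //; apply: hx; rewrite !inE eqxx ?orbT.
  by apply: (eQ y) => //; apply: hy; rewrite !inE eqxx ?orbT.
Qed.

End Reduction.

(** * Approximations *)

Section Approximations.
Variables (X : Type) (I : countType) (c : X -> I -> nat).
Variables (f : X -> cantor_space) (d : nat -> I).
Hypotheses (c_closed : closed_code c) (f_inj : injective f).
Hypothesis c_digit : forall x j, c x (d j) = cantor_code (f x) j.

Let Z := twins f.

Lemma base_digit (z : Z) j :
  twin_code c z (inl (d j.+1)) = cantor_code (base z) j.
Proof. by rewrite /= c_digit. Qed.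

(* A finite approximation [(m, L)] of a map from the Cantor space to the twins
   has level [size m]: the edges at s_j are to be sent to edges at s_(m_j), and
   [(t, i, v)] in [L] prescribes the value [v] of the coordinate [i] of the
   code on the sequences beginning with [t]. *)
Definition approx := (seq nat * seq (seq bool * (I + I) * nat))%type.

Definition level (a : approx) := size a.1.

(** The second clause is the finite form of the edge condition: it concerns the words s_j 0 w and
    s_j 1 w whose length is the level. *)
Definition compat (a : approx) (x : seq bool -> Z) :=
  (forall t i v, (t, i, v) \in a.2 -> size t = level a ->
     twin_code c (x t) i = v) /\
  (forall j w, j < level a -> size w + j.+1 = level a ->
     edge (nth 0 a.1 j) (base (x (s_ j ++ false :: w)))
                        (base (x (s_ j ++ true :: w)))).

(** For n the level, the next edge to be created joins s_n 0 and s_n 1, so the values at s_n are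
    those to be linked. *)
Definition centers (a : approx) (Y : set Z) : set Z :=
  [set x (s_ (level a)) | x in [set x | compat a x /\ forall t, Y (x t)]].

Definition large (a : approx) :=
  forall Y, small c (~` Y) -> ~ small c (centers a Y).

(* The last coordinates are prescribed so that the next m_k is larger than
   the previous ones. *)
Definition decided (m : seq nat) : seq (I + I) :=
  pmap pickle_inv (iota 0 (size m)) ++
  [seq inl (d j.+1) | j <- iota 0 (\max_(j <- m) j.+1)].

Definition good (a : approx) := forall t i, size t = level a ->
  i \in decided a.1 -> exists v, (t, i, v) \in a.2.

Definition extends (a a' : approx) := exists k,
  [/\ a'.1 = rcons a.1 k, forall j, j \in a.1 -> j < k,
      forall t i v b, (t, i, v) \in a.2 -> size t = level a ->
        (rcons t b, i, v) \in a'.2 &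
      good a'].

Definition glue (x x' : seq bool -> Z) (t : seq bool) : Z :=
  let u := take (size t).-1 t in if last false t then x' u else x u.

Lemma glue_rcons x x' t b : glue x x' (rcons t b) = if b then x' t else x t.
Proof.
by rewrite /glue last_rcons size_rcons -cats1 take_size_cat.
Qed.

(** The two maps become the halves of a map on words longer by one letter; the edge between their
    centers is the new edge required at s_n, for n the level. *)
Lemma glue_compat a x x' k : good a -> compat a x -> compat a x' ->
  edge k (base (x (s_ (level a)))) (base (x' (s_ (level a)))) ->
  exists a', extends a a' /\ compat a' (glue x x').
Proof.
move=> ga [xL xE] [x'L x'E] kE.
(* [L1] copies the old prescriptions to both one-letter extensions of each word; [L2] reads the
   coordinates now to be decided off the glued map. *)
pose L1 := [seq ((rcons q.1.1.1 q.2, q.1.1.2), q.1.2) |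
  q <- [seq (q, b) | q <- [seq q <- a.2 | size q.1.1 == level a], b <- [:: false; true]]].
pose L2 := [seq (q.1, q.2, twin_code c (glue x x' q.1) q.2) |
  q <- [seq (t, i) | t <- words (level a).+1, i <- decided (rcons a.1 k)]].
have lv L : level (rcons a.1 k, L) = (level a).+1 by rewrite /level /= size_rcons.
have L1P t i v : reflect
    (exists u b, [/\ t = rcons u b, size u = level a & (u, i, v) \in a.2])
    ((t, i, v) \in L1).
  apply: (iffP mapP) => [[[[[u i'] v'] b] /allpairsP [[q b'] /=]]|].
    rewrite mem_filter => -[/andP [/eqP su qa] _ [qE ->]] [-> -> ->].
    by exists u, b'; rewrite -qE in su qa; split.
  move=> [u [b [-> su ua]]]; exists ((u, i, v), b) => //.
  apply/allpairsP; exists ((u, i, v), b); split=> //=.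
    by rewrite mem_filter /= su eqxx.
  by case: b.
exists (rcons a.1 k, L1 ++ L2); split.
  exists k; split=> //=.
  (* All digits up to the largest earlier index are prescribed at the center, hence equal for [x]
     and [x'], whereas an edge at [k] makes digit [k] differ. *)
  - move=> j ja; rewrite ltnNge; apply/negP => kj.
    have kd : inl (d k.+1) \in decided a.1.
      rewrite mem_cat; apply/orP; right; apply: (map_f (fun j => inl (d j.+1))).
      rewrite mem_iota add0n; apply: leq_trans (_ : j.+1 <= _) => //.
      by apply: (@leq_bigmax_seq _ _ (fun=> true) (fun j => j.+1)).
    have [v hv] := ga _ _ (size_s_ (level a)) kd.
    have /eqP := edge_neq k kE; rewrite eqxx => /eqP/negP; apply.
    apply/eqP/cantor_codeE; rewrite -!base_digit.
    by rewrite (xL _ _ _ hv) ?size_s_// (x'L _ _ _ hv) ?size_s_.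
  - move=> t i v b ta st; rewrite mem_cat; apply/orP; left; apply/L1P.
    by exists t, b.
  - move=> t i; rewrite lv /= => st id.
    exists (twin_code c (glue x x' t) i); rewrite mem_cat; apply/orP; right.
    apply: (map_f (fun q : seq bool * (I + I) =>
      (q.1, q.2, twin_code c (glue x x' q.1) q.2)) (x := (t, i))).
    by apply/allpairsP; exists (t, i); split=> //; rewrite -st; apply: mem_words.
split=> [t i v /=|j w]; rewrite lv.
  rewrite mem_cat => /orP[/L1P [u [b [-> su ua]]] _|].
    by rewrite glue_rcons; case: b; [apply: x'L|apply: xL].
  by move=> /mapP [[t' i'] _ [-> -> ->]].
(* If [j] is the old level, [w] is empty and this is the new edge; otherwise the last letter of [w]
   selects the copy, and the edge is an old one. *)
rewrite ltnS leq_eqVlt => /predU1P[->|ja].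
  case: w => [_|? ? /=]; last by lia.
  by rewrite !cats1 !glue_rcons /= nth_rcons ltnn eqxx.
case/lastP: w => [/=|w b]; first by lia.
rewrite size_rcons => sw.
rewrite -!rcons_cons -!rcons_cat !glue_rcons /= nth_rcons ja.
by case: b; [apply: x'E|apply: xE] => //; lia.
Qed.

(** If no extension is large, each extension [a'] has a witness [Y a']. There are countably many
    approximations, so the exceptional sets together form a small set [N]. Off it, two compatible
    maps with linked centers would glue to a map compatible with some extension and with center in
    [N]. So there are no such links, and [borel_rectangle] makes the centers small. *)
Lemma large_extends a : good a -> large a -> exists2 a', extends a a' & large a'.
Proof.
move=> ga la; apply: contrapT => nl.
have [a'|Y hY] := @choice approx (set Z) (fun a' Y => extends a a' ->
    small c (~` Y) /\ small c (centers a' Y)).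
  have [ea|nea] := pselect (extends a a'); last by exists setT.
  have [Y hY] : exists Y, small c (~` Y) /\ small c (centers a' Y).
    apply: contrapT => /forallNP nY; apply: nl; exists a' => // Y sY sc.
    by apply: (nY Y).
  by exists Y.
pose N : set Z := \bigcup_a' if `[< extends a a' >] then
  ~` Y a' `|` centers a' (Y a') else set0.
have [P [Q [bPQ nPQ NPQ]]] : small c N.
  apply: small_bigcup => a'; case: asboolP => [/hY []|_]; last exact: small0.
  exact: smallU.
(* [V] replaces the complement of [N]: it is closed for the refined code [e], so that the compatible
   maps into [V] have a closed code. *)
pose V : set Z := [set z | forall i, ~ (P i (fst_twin z) /\ Q i (snd_twin z))].
have VN z : V z -> ~ N z by move=> Vz /NPQ [i]; apply: Vz.
have sV : small c (~` V).
  by exists P, Q; split=> // z /existsNP [i /contrapT h]; exists i.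
apply: (la V) => //.
have [rP crP hP] := borel_family (fun i => (bPQ i).1).
have [rQ crQ hQ] := borel_family (fun i => (bPQ i).2).
pose e := pair_code c (pair_code rP rQ).
have ec : closed_code e.
  by apply: closed_pair_code => //; apply: closed_graph_pair.
have ed x j : e x (inl (d j)) = cantor_code (f x) j by exact: c_digit.
have tc : closed_code (@twin_code _ f _ e) := closed_twin_code ec ed.
pose W := {x : seq bool -> Z | compat a x /\ forall t, V (x t)}.
pose cW (w : W) (p : seq bool * _) := twin_code e (sval w p.1) p.2.
have cWc : closed_code cW.
  apply: (@closed_code_sig _ _ (fun (x : seq bool -> Z) p => twin_code e (x p.1) p.2)).
    exact: closed_code_fun.
  move=> x hx.
  split; first split.
  - move=> t i v tL st.
    pose i' := match i with inl j => inl (inl j) | inr j => inr (inl j) end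
      : (I + (nat * nat + nat * nat)) + (I + (nat * nat + nat * nat)).
    have tE (z : Z) : twin_code e z i' = twin_code c z i by rewrite /i'; case: i {tL i'}.
    have [x' [[x'L _] _] /(_ (t, i') (mem_head _ _)) /=] := hx [:: (t, i')].
    by rewrite !tE => <-; apply: x'L.
  - move=> j w ja sw; apply: edge_closed => s.
    pose l t := [seq (t : seq bool, inl (inl (d i.+1)) :
      (I + (nat * nat + nat * nat)) + (I + (nat * nat + nat * nat))) | i <- s].
    have [x' [[_ x'E] _] /agree_cat [h0 h1]] :=
      hx (l (s_ j ++ false :: w) ++ l (s_ j ++ true :: w)).
    have lE t : agree (l t) (fun p => twin_code e (x' p.1) p.2)
        (fun p => twin_code e (x p.1) p.2) ->
        agree s (cantor_code (base (x' t))) (cantor_code (base (x t))).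
      move=> h i si; rewrite -!base_digit.
      exact: (h (t, inl (inl (d i.+1))) (map_f _ si)).
    by do 2!eexists; split; [exact: x'E ja sw|exact: lE|exact: lE].
  - move=> t i [/hP Pt /hQ Qt].
    have [x' [_ /(_ t i) Vx'] hh] :=
      hx [:: (t, inl (inr (inl (i, 0)))); (t, inr (inr (inr (i, 0))))].
    apply: Vx'; split.
      by apply/hP; have /= -> := hh (t, inl (inr (inl (i, 0)))) (mem_head _ _).
    apply/hQ; have /= -> // := hh (t, inr (inr (inr (i, 0)))).
    by rewrite !inE eqxx orbT.
have nK k (w w' : W) : ~ link f k (fst_twin (sval w (s_ (level a))))
    (snd_twin (sval w' (s_ (level a)))).
  case: w w' => [x [ax Vx]] [x' [ax' Vx']] [_ _] /=; rewrite base_snd -/(base _) => ke.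
  (* For odd [k] the link is an edge in the reverse direction, and the two maps are exchanged. *)
  have [y [y' [k' [[ay Vy] [ay' Vy'] ky]]]] : exists y y' k',
      [/\ compat a y /\ (forall t, V (y t)), compat a y' /\ (forall t, V (y' t)) &
      edge k' (base (y (s_ (level a)))) (base (y' (s_ (level a))))].
    by case: (odd k) ke => ke; [exists x', x, k./2|exists x, x', k./2].
  have [a' [ea ca]] := glue_compat ga ay ay' ky.
  have Vg t : V (glue y y' t) by rewrite /glue; case: ifP.
  have YV z : V z -> Y a' z /\ ~ centers a' (Y a') z.
    move=> /VN nz; split; [apply: contrapT => nY; apply: nz|move=> cz; apply: nz];
      exists a' => //; case: asboolP => // _; by [left|right].
  have [_] := YV _ (Vg (s_ (level a'))); apply.
  by exists (glue y y') => //; split=> // t; have [] := YV _ (Vg t).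
have wc (g : Z -> X) (q : I -> (I + (nat * nat + nat * nat)) + (I + (nat * nat + nat * nat))) :
    (forall z i, c (g z) i = twin_code e z (q i)) ->
    code_cont cW c (fun w => g (sval w (s_ (level a)))).
  move=> hg w i; exists [:: (s_ (level a), q i)] => w' /(_ _ (mem_head _ _)) /= h.
  by rewrite !hg.
have [P' [Q' [bP' bQ' hPQ' nPQ']]] := borel_rectangle (link_closed c_digit)
  (digit_code_inj f_inj c_digit) c_closed cWc
  (wc (@fst_twin X f) (fun i => inl (inl i)) (fun _ _ => erefl))
  (wc (@snd_twin X f) (fun i => inr (inl i)) (fun _ _ => erefl)) nK.
apply: small_rect bP' bQ' nPQ' _ => z [x hx <-].
exact: (hPQ' (exist _ x hx)).
Qed.

(** At level 0 nothing is imposed, so constant maps make every point of [Y] a center. *)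
Lemma large_nil : ~ small c [set: Z] -> large ([::], [::]).
Proof.
move=> ns Y sY sc; apply: ns; apply: smallS (smallU sY sc) => z _.
have [Yz|] := pselect (Y z); last by left.
by right; exists (fun=> z).
Qed.

End Approximations.

(** * The limit map *)

Lemma mkseq_prepend n e (g : cantor_space) N : n < N ->
  mkseq (prepend (rcons (s_ n) e) g) N = s_ n ++ e :: mkseq g (N - n.+1).
Proof.
move=> nN; apply: (@eq_from_nth _ false) => [|i].
  by rewrite size_cat /= !size_mkseq size_s_; lia.
rewrite size_mkseq => iN; rewrite nth_mkseq// /prepend size_rcons size_s_.
rewrite nth_cat nth_rcons size_s_ ltnS; case: (ltngtP i n) => h; last by rewrite h subnn.
- by [].
- by rewrite -[i - n]prednK ?subn_gt0//= nth_mkseq; [congr g; lia|lia].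
Qed.

Section Limit.
Variables (X : Type) (I : countType) (c : X -> I -> nat).
Variables (f : X -> cantor_space) (d : nat -> I).
Hypotheses (c_closed : closed_code c) (f_inj : injective f).
Hypothesis c_digit : forall x j, c x (d j) = cantor_code (f x) j.

Lemma large_sequence : ~ small c [set: twins f] ->
  exists a : nat -> approx I, a 0 = ([::], [::]) /\
    forall n, large c f (a n) /\ extends d (a n) (a n.+1).
Proof.
move=> ns.
have [a|g hg] := @choice (approx I) (approx I) (fun a b => good d a -> large c f a ->
    extends d a b /\ large c f b).
  have [[ga la]|n] := pselect (good d a /\ large c f a); last first.
    by exists a => ga la; case: n.
  by have [b eb lb] := large_extends c_closed f_inj c_digit ga la; exists b.
exists (fun n => iter n g ([::], [::])); split=> // n.
suff [ga la] : good d (iter n g ([::], [::])) /\ large c f (iter n g ([::], [::])).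
  by split=> //; have [] := hg _ ga la.
elim: n => [|n [ga la]] /=.
  split; last exact: large_nil.
  by move=> t i _; rewrite /decided /= big_nil.
by have [[k [_ _ _ ?]] ?] := hg _ ga la.
Qed.

(** Along the sequence of approximations each coordinate is eventually prescribed on all words,
    consistently under extension. The prescribed values [y] are limits of codes of twins, hence
    codes of twins [G]; the edge conditions pass to the limit because edges at a fixed index form a
    closed set. *)
Lemma limit_map : ~ small c [set: twins f] ->
  exists (m : nat -> nat) (G : cantor_space -> twins f),
  [/\ forall i j, i < j -> m i < m j,
      forall k g, edge (m k) (base (G (prepend (rcons (s_ k) false) g)))
                             (base (G (prepend (rcons (s_ k) true) g))) &
      forall a i, exists n, forall b : cantor_space, (forall j, j < n -> b j = a j) ->
        twin_code c (G b) i = twin_code c (G a) i].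
Proof.
move=> /large_sequence [a [a0 ha]].
have lv n : level (a n) = n.
  elim: n => [|n IH]; first by rewrite a0.
  by have [_ [k [E _ _ _]]] := ha n; rewrite /level E size_rcons -/(level _) IH.
have gd n : good d (a n.+1) by have [_ [k []]] := ha n.
pose m k := last 0 (a k.+1).1.
have mE n j : j < n -> nth 0 (a n).1 j = m j.
  elim: n j => // n IH j; rewrite ltnS leq_eqVlt => jn.
  have [_ [k [E _ _ _]]] := ha n; rewrite E nth_rcons -/(level _) lv.
  case/predU1P: jn => [->|jn]; last by rewrite jn IH.
  by rewrite ltnn eqxx /m E last_rcons.
have minc i j : i < j -> m i < m j.
  move=> ij; have [_ [k [E h _ _]]] := ha j; rewrite {2}/m E last_rcons.
  by apply: h; rewrite -(mE j i ij); apply: mem_nth; rewrite -/(level _) lv.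
(* From this level on, coordinate [i] is among the [decided] ones. *)
pose N (i : I + I) := (pickle i).+1.
have [p|y hy] := @choice (seq bool * (I + I)) nat (fun p v =>
    size p.1 = N p.2 -> (p.1, p.2, v) \in (a (N p.2)).2).
  have [st|ns] := pselect (size p.1 = N p.2); last by exists 0.
  have [||v hv] := gd (pickle p.2) p.1 p.2; first by rewrite lv.
    rewrite /decided mem_cat mem_pmap; apply/orP; left; apply/mapP.
    exists (pickle p.2); last by rewrite pickleK_inv.
    by rewrite mem_iota -/(level _) lv add0n ltnS leqnn.
  by exists v.
have yL (x : cantor_space) i n : N i <= n ->
    (mkseq x n, i, y (mkseq x (N i), i)) \in (a n).2.
  move=> /subnK <-; elim: (n - N i) => [|k IH].
    by apply: (hy (mkseq x (N i), i)); rewrite size_mkseq.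
  have [_ [_ [_ _ + _]]] := ha (k + N i); rewrite addSn mkseqS; apply => //.
  by rewrite size_mkseq lv.
have xi n : exists x : seq bool -> twins f, compat c (a n) x /\ forall x' i, N i <= n ->
    twin_code c (x (mkseq x' n)) i = y (mkseq x' (N i), i).
  (* A compatible map exists because the centers of a large approximation are not small, hence not
     empty. *)
  have [_ [x [cx _] _]] : centers c (a n) [set: twins f] !=set0.
    apply/set0P/eqP => e; have [/(_ setT) la _] := ha n.
    by apply: la; rewrite ?setCT ?e; apply: small0.
  exists x; split=> // x' i ni; apply: cx.1; first exact: yL.
  by rewrite size_mkseq lv.
have [x'|G hG] := @choice cantor_space (twins f) (fun x z =>
    twin_code c z = fun i => y (mkseq x (N i), i)).
  apply: (closed_twin_code c_closed c_digit) => s.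
  have [x [cx hx]] := xi (\max_(i <- s) N i).
  exists (x (mkseq x' (\max_(i <- s) N i))) => i si; apply: hx.
  exact: leq_bigmax_seq.
exists m, G; split=> //; last first.
  move=> x i; exists (N i) => x' hx; rewrite !hG; congr (y (_, _)).
  apply: (@eq_from_nth _ false); rewrite !size_mkseq// => j jn.
  by rewrite !nth_mkseq ?hx.
move=> k g; apply: edge_closed => s.
(* A level beyond [k], where the edge condition at [k] is in force, and at which all digits in [s]
   already have their final values. *)
pose n := maxn k.+1 (\max_(i <- s) N (inl (d i.+1))).
have [x [[_ cx] hx]] := xi n.
have kn : k < n by rewrite leq_max leqnn.
have hs e : agree s
    (cantor_code (base (x (s_ k ++ e :: mkseq g (n - k.+1)))))
    (cantor_code (base (G (prepend (rcons (s_ k) e) g)))).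
  move=> i si; rewrite -!(base_digit c_digit) hG -mkseq_prepend// hx//.
  rewrite leq_max; apply/orP; right.
  by apply: (@leq_bigmax_seq _ _ (fun=> true) (fun i => N (inl (d i.+1)))).
do 2!eexists; split; [|exact: hs|exact: hs].
by rewrite -(mE n)//; apply: cx; rewrite lv// size_mkseq subnK.
Qed.

End Limit.

(** * Rigidity of maps sending edges to edges of increasing index *)

Section Rigidity.
Variables (h : cantor_space -> cantor_space) (m : nat -> nat).
Hypothesis m_incr : forall i j, i < j -> m i < m j.
Hypothesis h_edge : forall k g,
  edge (m k) (h (prepend (rcons (s_ k) false) g))
             (h (prepend (rcons (s_ k) true) g)).

(* Flipping the first k digits only moves the coordinates m_0, ..., m_(k-1):
   the sequences of length k form a tree whose edges are copies of the s_j. *)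
Lemma edge_map_prefix u v g i : size u = size v -> (forall j, j < size u -> m j != i) ->
  h (prepend u g) i = h (prepend v g) i.
Proof.
elim/last_ind: u v g => [|u b IH] v g; first by case: v.
case/lastP: v => [|v b']; rewrite !size_rcons // => -[uv] hi.
have uI (w : seq bool) e : size w = size u ->
    h (prepend (rcons w e) g) i = h (prepend (rcons (s_ (size u)) e) g) i.
  move=> wu; rewrite -!cats1 (prepend_cat w) (prepend_cat (s_ _)).
  rewrite -(IH w) ?wu//; last by move=> j ju; apply: hi; rewrite ltnS ltnW.
  by apply: IH; rewrite ?size_s_// => j ju; apply: hi; rewrite ltnS ltnW.
rewrite uI// uI//.
suff E e : h (prepend (rcons (s_ (size u)) e) g) i =
    h (prepend (rcons (s_ (size u)) false) g) i by rewrite E [RHS]E.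
case: e => //; apply/esym/eqP/negPn; rewrite (edge_neq i (h_edge (size u) g)).
by rewrite eq_sym; apply: hi.
Qed.

(** Replacing the first k digits of [a] by s_k leaves coordinate m_k unchanged, since the earlier
    indices are smaller; the edge at s_k then shows digit k of [a] at m_k. *)
Lemma edge_map_digit a k : h a (m k) = a k.
Proof.
have aE : a = prepend (rcons (mkseq a k) (a k)) (fun i => a (i + k.+1)).
  apply/funext => i; rewrite /prepend size_rcons size_mkseq nth_rcons size_mkseq.
  rewrite ltnS; case: (ltngtP i k) => [ik|ik|->] //; first by rewrite nth_mkseq.
  by rewrite subnK.
rewrite {1}aE -cats1 prepend_cat (@edge_map_prefix _ (s_ k)) ?size_mkseq ?size_s_//.
  rewrite -prepend_cat cats1; have [_ _ h0 h1 _] := h_edge k (fun i => a (i + k.+1)).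
  by case: (a k).
by move=> j /m_incr; rewrite neq_ltn => ->.
Qed.

Lemma edge_map_inj : injective h.
Proof. by move=> a b ab; apply/funext => k; rewrite -(edge_map_digit a) ab edge_map_digit. Qed.

(** Digit k of a point is visible at m_k in its image, so an image pair differing only at l comes
    from a pair differing exactly at the k with m_k = l. Such a k exists, as otherwise a = b. *)
Lemma edge_map_G0 a b : G0 (h a, h b) <-> G0 (a, b).
Proof.
split=> [/G0P [l e]|[n [g [-> ->]]]]; last by apply/G0P; exists (m n).
have ab k : (a k != b k) = (m k == l).
  by rewrite -(edge_map_digit a) -(edge_map_digit b) (edge_neq _ e).
have [k mk] : exists k, m k = l.
  apply: contrapT => /forallNP nk.
  have E : a = b by apply/funext => k; apply/eqP/negPn; rewrite ab; apply/eqP.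
  by have := edge_neq l e; rewrite E !eqxx.
subst l; apply/G0P; exists k.
have m_neq i : i != k -> m i != m k.
  by rewrite !neq_ltn => /orP[/m_incr ->//|/m_incr ->]; rewrite orbT.
have [e1 e2 e3 e4 _] := e.
have abi i : i != k -> a i = b i.
  by move=> ik; apply/eqP/negPn; rewrite ab m_neq.
(* [h a] and the image of s_k 0 followed by zeros both start with s_(m_k), so they agree at m_i,
   where they show digit i of [a] and of s_k. *)
have ai i : i < k -> a i = nth false (s_ k) i.
  move=> ik; have [f1 _ _ _ _] := h_edge k (fun=> false).
  rewrite -(edge_map_digit a) e1 ?m_incr// -f1 ?m_incr// edge_map_digit /prepend.
  by rewrite size_rcons size_s_ ltnS ltnW// nth_rcons size_s_ ik.
split=> // [i ik|||i ik].
- by rewrite -abi ?ai// neq_ltn ik.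
- by rewrite -(edge_map_digit a).
- by rewrite -(edge_map_digit b).
- by rewrite abi// neq_ltn ik orbT.
Qed.

End Rigidity.

(** * Minimality of [T0] *)

Lemma continuous_closed_graph (X : topologicalType) (I : countType)
    (c : X -> I -> nat) (f : X -> cantor_space) :
  (forall (x : X) V, nbhs x V -> code_open c V x) -> continuous f ->
  closed_graph c (fun x => cantor_code (f x)).
Proof.
move=> co fc x y hy; apply/funext => j.
have /co [s hs] : nbhs x (f @^-1` [set b | b j = f x j]).
  apply/fc/cantor_code_nbhs; exists [:: j] => b /(_ j (mem_head _ _)).
  by move/cantor_codeE.
have [x' hx <-] := hy s [:: j]; last by rewrite mem_head.
by apply/esym/cantor_codeE; apply: hs; apply: agree_sym.
Qed.

(** The reduction [F] sends 0a and 1a to the two members of the twin [G a]. Then [f] maps [F (ea)]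
    to e followed by [h a], so injectivity and the reduction property come from the rigidity of
    [h]. *)
Lemma reduces_T0 (X : topologicalType) (I : countType) (c : X -> I -> nat)
    (f : X -> cantor_space) (d : nat -> I) (S : set (X * X)) :
  closed_code c -> injective f ->
  (forall x j, c x (d j) = cantor_code (f x) j) ->
  (forall (x : X) V, nbhs x V -> code_open c V x) ->
  (forall x y, T0 (f x, f y) <-> S (x, y)) -> ~ small c [set: twins f] ->
  reduces_c T0 S.
Proof.
move=> cc fi cd co fS /(limit_map cc fi cd) [m [G [minc Gedge Gcont]]].
pose h a := base (G a).
pose F (a : cantor_space) : X :=
  if a 0 then snd_twin (G (tail a)) else fst_twin (G (tail a)).
have F0 a : f (F a) 0 = a 0.
  by rewrite /F; case: (a 0); have [] := svalP (G (tail a)).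
have Ft a : tail (f (F a)) = h (tail a).
  by rewrite /F; case: (a 0) => //; apply: base_snd.
exists F; split.
- move=> a b ab; rewrite -(prepend_tail a) -(prepend_tail b) -(F0 a) -(F0 b) ab.
  congr prepend; apply: (@edge_map_inj h m minc Gedge).
  by rewrite -(Ft a) -(Ft b) ab.
- move=> a V /co [s hs]; apply: cantor_code_nbhs.
  have [n hn] : exists n, forall b : cantor_space, (forall j, j < n -> b j = tail a j) ->
      agree (map inl s ++ map inr s) (twin_code c (G b)) (twin_code c (G (tail a))).
    elim: (_ ++ _) => [|i t [n hn]]; first by exists 0.
    have [k hk] := Gcont (tail a) i; exists (maxn n k) => b hb j.
    rewrite inE => /predU1P[->|].
      by apply: hk => l lk; apply: hb; rewrite leq_max lk orbT.
    by apply: hn => l ln; apply: hb; rewrite leq_max ln.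
  exists (iota 0 n.+1) => b hb; apply: hs => i si.
  have ab j : j < n.+1 -> a j = b j.
    by move=> jn; apply/cantor_codeE; apply: hb; rewrite mem_iota.
  have /hn /agree_pair [h1 h2] : forall j, j < n -> tail b j = tail a j.
    by move=> j jn; rewrite /tail ab.
  by rewrite /F -ab//; case: (a 0); apply/esym; [exact: h2|exact: h1].
- move=> a b; rewrite -fS; apply: (iff_trans (T0P _ _)); rewrite !F0 !Ft.
  apply: iff_trans (iff_sym (T0P a b)).
  by rewrite (@edge_map_G0 h m minc Gedge).
Qed.

Theorem theorem7p11 (R : realType) : minimal_non_pot_closed R T0.
Proof.
split; first exact: T0_not_pot_closed.
move=> X S PX nS [f [fi fc fS]].
have [c0 [cc0 co0]] := polish_code PX.
(* The digits of [f] are added as coordinates; continuity of [f] keeps the range closed. *)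
pose c := pair_code c0 (fun x => cantor_code (f x)).
have cc : closed_code c.
  by apply: closed_pair_code => //; apply: continuous_closed_graph.
have cd x j : c x (inr j) = cantor_code (f x) j by [].
have co (x : X) V : nbhs x V -> code_open c V x.
  move=> /co0 [s hs]; exists (map inl s ++ map inr [::]) => x'.
  by move=> /agree_pair [h _]; apply: hs.
apply: (reduces_T0 cc fi cd co fS) => sm.
have [J [e [ec ei ce eS]]] := small_code cc fi cd sm.
apply: nS; apply: (code_pot_closed R ec ei).
  by move=> x V /co; apply: ce.
move=> x y nSxy; have [|s hs] := eS x y; first by rewrite fS.
by exists s => x' y' hx hy; rewrite -fS; apply: hs.
Qed.
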